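(* Let $(X_n)_{n\ge 0}$ be a Galton--Watson process with immigration such that $\varepsilon$ is regularly varying with index $\gamma \in [0,\infty)$, $\mathbb{P}(\xi = 0) < 1$ and there exists $r \in (\max(1,\gamma),\infty)$ with $\mathbb{E}(\xi^r) < \infty$ and $\mathbb{E}(X_0^r) < \infty$. Then for each $n \in \mathbb{N}$, we have $$\mathbb{P}(X_n > x) \sim \sum_{i=1}^n m_\xi^{(n-i)\gamma}\, \mathbb{P}(\varepsilon > x) \qquad \text{as } x \to \infty,$$ and hence $X_n$ is also regularly varying with index $\gamma$.
   Context: A Galton--Watson process with immigration is a stochastic process $(X_n)_{n\ge 0}$ given by $X_n = \sum_{i=1}^{X_{n-1}} \xi_{n,i} + \varepsilon_n$, $n \ge 1$, where $\{X_0, \xi_{n,i}, \varepsilon_n : n,i \ge 1\}$ are independent non-negative integer-valued random variables, the $\xi_{n,i}$ ($n,i\ge1$) are identically distributed, the $\varepsilon_n$ ($n\ge 1$) are identically distributed, and $\sum_{i=1}^0 := 0$. Here $\xi$ and $\varepsilon$ denote random variables with the distribution of $\xi_{1,1}$ and $\varepsilon_1$, respectively, and $m_\xi := \mathbb{E}(\xi)$. $\mathbb{N} = \{1,2,\ldots\}$. A non-negative random variable $X$ is regularly varying with index $\alpha \in [0,\infty)$ if $\mathbb{P}(X > x) > 0$ for all $x > 0$ and $\lim_{x\to\infty} \mathbb{P}(X > qx)/\mathbb{P}(X > x) = q^{-\alpha}$ for all $q > 0$. $f(x) \sim g(x)$ as $x\to\infty$ means $\lim_{x\to\infty} f(x)/g(x)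 = 1$. *)

(* Defs.v *)
From HB Require Import structures.
From mathcomp Require Import all_boot all_order all_algebra finmap.
From mathcomp Require Import all_classical all_reals all_analysis.

Set Implicit Arguments.
Unset Strict Implicit.
Unset Printing Implicit Defensive.

Import Order.TTheory GRing.Theory Num.Theory.
Import numFieldNormedType.Exports.

Local Open Scope classical_set_scope.
Local Open Scope ring_scope.

Definition asymp_equiv (R : realType) (f g : R -> R) : Prop :=
  f x / g x @[x --> +oo] --> (1 : R).

Section embedding.
Context {R : realType}.

Definition natr_fun (n : nat) : R := n%:R.

Let measurable_natr_fun : measurable_fun [set: nat] natr_fun.
Proof. by []. Qed.

HB.instance Definition _ :=
  isMeasurableFun.Build _ _ _ _ natr_fun measurable_natr_fun.
End embedding.

Section random_variables.
Context d (T : measurableType d) (R : realType) (P : probability T R).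

Definition realRV (X : {RV P >-> nat}) : {RV P >-> R} :=
  [the {mfun T >-> R} of @natr_fun R \o X].

Definition tail (X : {RV P >-> R}) (x : R) : R := fine (ccdf X x).

Definition regularly_varying (X : {RV P >-> R}) (alpha : R) : Prop :=
  [/\ forall w, 0 <= X w,
      forall x, 0 < x -> 0 < tail X x &
      forall q, 0 < q -> tail X (q * x) / tail X x @[x --> +oo] --> q `^ (- alpha)].

Definition mutually_independent d' (T' : measurableType d') (I : choiceType)
    (Y : I -> {RV P >-> T'}) : Prop :=
  forall (J : {fset I}) (A : I -> set T'),
    (forall i, i \in J -> measurable (A i)) ->
    P (\bigcap_(i in [set` J]) Y i @^-1` A i) =
    (\prod_(i <- J) P (Y i @^-1` A i))%E.

Definition eq_distribution d' (T' : measurableType d')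
    (X Y : {RV P >-> T'}) : Prop :=
  forall A, measurable A -> distribution P X A = distribution P Y A.

(* The innovations are indexed from 0: [xi n i] and [eps n] stand for
   xi_{n+1,i+1} and eps_{n+1}, so that no unused variable is constrained. *)
Definition gwi_family (X0 : {RV P >-> nat}) (xi : nat -> nat -> {RV P >-> nat})
    (eps : nat -> {RV P >-> nat}) (k : unit + (nat * nat + nat)) :
    {RV P >-> nat} :=
  match k with
  | inl _ => X0
  | inr (inl ni) => xi ni.1 ni.2
  | inr (inr n) => eps n
  end.

Record is_GWI (X : nat -> {RV P >-> nat}) (xi : nat -> nat -> {RV P >-> nat})
    (eps : nat -> {RV P >-> nat}) : Prop := {
  gwi_rec : forall n w, X n.+1 w = (\sum_(i < X n w) xi n i w + eps n w)%N ;
  gwi_indep : mutually_independent (gwi_family (X 0%N) xi eps) ;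
  gwi_xi_id : forall n i, eq_distribution (xi n i) (xi 0%N 0%N) ;
  gwi_eps_id : forall n, eq_distribution (eps n) (eps 0%N) }.

Definition mean (X : {RV P >-> nat}) : R := fine 'E_P[realRV X].

Definition finite_moment (X : {RV P >-> nat}) (r : R) : Prop :=
  ('E_P[fun w => (realRV X w `^ r)%R] < +oo)%E.

End random_variables.

(* Main.v *)
Require Import Defs.
From HB Require Import structures.
From mathcomp Require Import all_boot all_order all_algebra finmap.
From mathcomp Require Import all_classical all_reals all_analysis.
From mathcomp Require Import measurable_realfun ring lra.

(** Write F for the tail of the immigration law. By induction on n, starting
at n = 0, the ratio P(X_n > x) / F x tends to c_n, with c_0 = 0 and
c_(n+1) = c_n m^gamma + 1 where m is the mean offspring number; unrolling the
recursion gives the announced constant, and c_n > 0 for n > 0 carries the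
regular variation of F over to X_n.

For n = 0, Markov's inequality bounds P(X_0 > x) by a multiple of x^(-r), which
is negligible against F because r > gamma. For the induction step, X_(n+1) is
the sum of eps_(n+1) and of the random sum S = xi_1 + ... + xi_N with N = X_n,
and these two summands are independent.

For independent summands whose tails are asymptotic to a F and b F, the tail of
the sum is asymptotic to (a + b) F (lemma [indep_sum_tail]): a large sum needs
one large summand, two large summands at once having negligible probability.

For the random sum (lemma [random_sum_tail]) the tail is c m^gamma F, because
S > x happens essentially when N > x / m. If N > q x with q > 1 / m, the law of
large numbers makes S > x almost certain ([lower_deviation]). If N = j with
j <= q x and q < 1 / m, then S > x is a large deviation above the mean, and a
Chernoff bound on truncated steps together with the chance of one big step
gives P(S > x | N = j) <= C (j + 1) x^(-r) ([upper_deviation]). Summing over j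
leaves x^(-r) (1 + E(N; N <= q x)), which is negligible against F since r
exceeds both 1 and gamma ([power_domination]). Letting q tend to 1 / m closes
the gap between the two bounds ([ratio_sandwich]).

The independence of N, of the steps and of the immigrants is read off from the
sigma-algebras generated by disjoint blocks of the underlying family
([indep_sigma_of]): each variable only needs to be located in its block. *)

Set Implicit Arguments.
Unset Strict Implicit.
Unset Printing Implicit Defensive.

Import Order.TTheory GRing.Theory Num.Theory.
Import numFieldNormedType.Exports.

Local Open Scope classical_set_scope.
Local Open Scope ring_scope.

(** * Independence of the sigma-algebras of disjoint blocks *)

Section independence.
Context d (T : measurableType d) (R : realType) (P : probability T R).

(** The pi-lambda theorem: the events independent of [C] are closed under
complements and disjoint countable unions. *)
Lemma indep_smallest (G : set (set T)) (C : set T) :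
  setI_closed G -> G `<=` measurable -> measurable C ->
  (forall B, G B -> P (B `&` C) = (P B * P C)%E) ->
  forall B, <<s G >> B -> measurable B /\ P (B `&` C) = (P B * P C)%E.
Proof.
move=> GI Gm mC GC B.
suff : <<s G >> `<=` [set B | measurable B /\ P (B `&` C) = (P B * P C)%E].
  exact.
apply: lambda_system_subset => //; last first.
  by move=> D GD; split; [exact: Gm|exact: GC].
apply/dynkin_lambda_system; split.
- by split => //; rewrite setTI probability_setT mul1e.
- move=> D [mD DC]; split; first exact: measurableC.
  rewrite probability_setC// setIC -setDE measureD//; last first.
    by rewrite -ge0_fin_numE ?fin_num_measure.
  have DC1 : P (C `&` D) = (P D * P C)%E by rewrite setIC.
  transitivity (P C - P D * P C)%E; first by congr (_ - _)%E; exact: DC1.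
  by rewrite muleBl ?mul1e// fin_num_measure.
- move=> F tF hF; have mF k : measurable (F k) by case: (hF k).
  split; first exact: bigcupT_measurable.
  rewrite setI_bigcupl measure_bigcup//; last 2 first.
    by move=> k _; exact: measurableI.
    exact: trivIset_setIr.
  have PC : P C \is a fin_num by rewrite fin_num_measure.
  rewrite measure_bigcup// muleC -(fineK PC) -nneseriesZl//.
  by apply: eq_eseriesr => k _; rewrite fineK// muleC; case: (hF k).
Qed.

Context d' (T' : measurableType d') (I : choiceType) (Y : I -> {RV P >-> T'}).

(** Cylinders are intersections over the whole index set, with [A i = setT] off
the finite support [J]; two cylinders then have a common support at no cost, and
an intersection of cylinders is computed coordinate by coordinate. *)
Definition cylinder (K : set I) (C : set T) : Prop :=
  exists (J : {fset I}) (A : I -> set T'),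
    [/\ forall i, measurable (A i), forall i, i \notin J -> A i = setT,
        forall i, ~ K i -> A i = setT & C = \bigcap_i (Y i @^-1` A i)].

Definition sigma_of (K : set I) : set (set T) := <<s cylinder K >>.

Lemma cylinderE (J : {fset I}) (A : I -> set T') :
  (forall i, i \notin J -> A i = setT) ->
  \bigcap_i (Y i @^-1` A i) = \bigcap_(i in [set` J]) (Y i @^-1` A i).
Proof.
move=> AJ; apply/seteqP; split => w /= hw i hi; first exact: hw.
by case: (boolP (i \in J)) => iJ; [exact: hw|rewrite /= AJ].
Qed.

Lemma measurable_cylinder K : cylinder K `<=` measurable.
Proof.
move=> _ [J [A [mA AJ _ ->]]]; rewrite (cylinderE AJ).
apply: fin_bigcap_measurable => [|i _]; first exact: finite_fset.
by rewrite -[X in measurable X]setTI; exact: measurable_funP.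
Qed.

Lemma cylinder_setI_closed K : setI_closed (cylinder K).
Proof.
move=> _ _ [J1 [A1 [mA1 AJ1 AK1 ->]]] [J2 [A2 [mA2 AJ2 AK2 ->]]].
exists (J1 `|` J2)%fset, (fun i => A1 i `&` A2 i); split.
- by move=> i; exact: measurableI.
- by move=> i; rewrite in_fsetU negb_or => /andP[/AJ1 -> /AJ2 ->]; rewrite setIT.
- by move=> i Ki; rewrite AK1// AK2// setIT.
- by rewrite -bigcapI; apply: eq_bigcapr => i _; rewrite preimage_setI.
Qed.

Hypothesis indepY : mutually_independent Y.

(** Over a common support, in every coordinate one of the two constraints is
trivial, so the two products of probabilities combine factor by factor. *)
Lemma indep_cylinder (K1 K2 : set I) B C : [disjoint K1 & K2]%classic ->
  cylinder K1 B -> cylinder K2 C -> P (B `&` C) = (P B * P C)%E.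
Proof.
move=> /disj_setPS K12 [J1 [A1 [mA1 AJ1 AK1 BE]]] [J2 [A2 [mA2 AJ2 AK2 CE]]].
pose J := (J1 `|` J2)%fset.
have prodE A : (forall i, measurable (A i)) -> (forall i, i \notin J -> A i = setT) ->
    P (\bigcap_i (Y i @^-1` A i)) = (\prod_(i <- J) P (Y i @^-1` A i))%E.
  by move=> mA AJ; rewrite (cylinderE AJ) indepY.
have AJ1' i : i \notin J -> A1 i = setT.
  by rewrite in_fsetU negb_or => /andP[/AJ1].
have AJ2' i : i \notin J -> A2 i = setT.
  by rewrite in_fsetU negb_or => /andP[_ /AJ2].
rewrite BE CE -bigcapI prodE// prodE//.
have -> : \bigcap_i (Y i @^-1` A1 i `&` Y i @^-1` A2 i) =
          \bigcap_i (Y i @^-1` (A1 i `&` A2 i)).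
  by apply: eq_bigcapr => i _; rewrite preimage_setI.
rewrite prodE; last 2 first.
  by move=> i; exact: measurableI.
  by move=> i iJ; rewrite AJ1'// AJ2'// setIT.
rewrite -big_split/=; apply: eq_bigr => i _; rewrite preimage_setI.
have [K1i|K1i] := pselect (K1 i).
  rewrite (AK2 i) ?preimage_setT ?setIT ?probability_setT ?mule1// => K2i.
  exact: (K12 i).
by rewrite (AK1 i)// preimage_setT setTI probability_setT mul1e.
Qed.

Lemma sigma_of_measurable K : sigma_of K `<=` measurable.
Proof.
apply: smallest_sub; first exact: sigma_algebra_measurable.
exact: measurable_cylinder.
Qed.

(** Two applications of the pi-lambda theorem, one for each block. *)
Lemma indep_sigma_of (K1 K2 : set I) B C : [disjoint K1 & K2]%classic ->
  sigma_of K1 B -> sigma_of K2 C -> P (B `&` C) = (P B * P C)%E.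
Proof.
move=> K12 K1B K2C.
suff : measurable B /\ P (B `&` C) = (P B * P C)%E by case.
apply: (indep_smallest _ _ (sigma_of_measurable K2C) _ K1B).
- exact: cylinder_setI_closed.
- exact: measurable_cylinder.
move=> {}B {}K1B; rewrite setIC muleC.
suff : measurable C /\ P (C `&` B) = (P C * P B)%E by case.
apply: (indep_smallest _ _ (measurable_cylinder K1B) _ K2C).
- exact: cylinder_setI_closed.
- exact: measurable_cylinder.
move=> {}C {}K2C; rewrite setIC muleC.
exact: indep_cylinder K12 K1B K2C.
Qed.

End independence.

Section determined.
Context d (T : measurableType d) (R : realType) (P : probability T R).
Context (I : choiceType) (Y : I -> {RV P >-> nat}).

Definition determined (K : set I) (Z : T -> nat) : Prop :=
  forall A, sigma_of Y K (Z @^-1` A).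

Lemma sigma_of_subset (K1 K2 : set I) :
  K1 `<=` K2 -> sigma_of Y K1 `<=` sigma_of Y K2.
Proof.
move=> K12; apply: sub_smallest2r; first exact: smallest_sigma_algebra.
move=> C [J [A [mA AJ AK CE]]]; exists J, A; split => // i Ki.
by apply: AK => /K12.
Qed.

Lemma determined_subset (K1 K2 : set I) Z :
  K1 `<=` K2 -> determined K1 Z -> determined K2 Z.
Proof. by move=> K12 dZ A; exact: (sigma_of_subset K12). Qed.

Lemma sigma_of_bigcup (K : set I) (F : nat -> set T) :
  (forall n, sigma_of Y K (F n)) -> sigma_of Y K (\bigcup_n F n).
Proof.
by have [_ _ + ?] := smallest_sigma_algebra setT (cylinder Y K); apply.
Qed.

Lemma sigma_of_setI (K : set I) B C :
  sigma_of Y K B -> sigma_of Y K C -> sigma_of Y K (B `&` C).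
Proof.
have := smallest_sigma_algebra setT (cylinder Y K).
move=> /sigma_algebraP => /(_ (fun _ _ => @subsetT _ _)) [_ _ _].
exact.
Qed.

Lemma sigma_of_setT (K : set I) : sigma_of Y K setT.
Proof.
apply: sub_sigma_algebra; exists fset0, (fun=> setT); split => //.
by apply/seteqP; split.
Qed.

Lemma determined_coord (K : set I) i : K i -> determined K (Y i).
Proof.
move=> Ki A; apply: sub_sigma_algebra.
exists [fset i]%fset, (fun j => if j == i then A else setT); split => //.
- by move=> j; rewrite in_fset1 => /negbTE ->.
- by move=> j; case: eqP => // ->.
- apply/seteqP; split => w /=; first by move=> h j _ /=; case: eqP => // ->.
  by move=> /(_ i Logic.I); rewrite /= eqxx.
Qed.

Lemma determined_cst (K : set I) k : determined K (fun=> k).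
Proof.
move=> A; rewrite preimage_cst; case: ifPn => _; first exact: sigma_of_setT.
by have [] := smallest_sigma_algebra setT (cylinder Y K).
Qed.

(** Covers both the random sum, where the number of terms is itself random, and,
with constant [Z], arbitrary functions of a variable. *)
Lemma determined_random (K : set I) N (Z : nat -> T -> nat) :
  determined K N -> (forall k, determined K (Z k)) ->
  determined K (fun w => Z (N w) w).
Proof.
move=> dN dZ A.
have -> : (fun w => Z (N w) w) @^-1` A =
    \bigcup_k (N @^-1` [set k] `&` Z k @^-1` A).
  by apply/seteqP; split=> [w Aw|w [k _ [/= -> ]]//]; exists (N w).
by apply: sigma_of_bigcup => k; apply: sigma_of_setI; [exact: dN|exact: dZ].
Qed.

Lemma determined_comp2 (K : set I) (f : nat -> nat -> nat) Z1 Z2 :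
  determined K Z1 -> determined K Z2 ->
  determined K (fun w => f (Z1 w) (Z2 w)).
Proof.
move=> d1 d2; apply: (determined_random (Z := fun k w => f k (Z2 w)) d1) => k.
apply: (determined_random (Z := fun l _ => f k l) d2) => l.
exact: determined_cst.
Qed.

Lemma determined_measurable (K : set I) Z A :
  determined K Z -> measurable (Z @^-1` A).
Proof. by move=> dZ; exact: (sigma_of_measurable (dZ A)). Qed.

End determined.

(** * Real-valued probabilities and moments of integer variables *)

Section real_probability.
Context d (T : measurableType d) (R : realType) (P : probability T R).
Implicit Types (B C : set T) (Z : T -> nat).

Definition prob B : R := fine (P B).

Lemma prob_ge0 B : 0 <= prob B.
Proof. exact: fine_ge0. Qed.

Lemma EFin_prob B : measurable B -> (prob B)%:E = P B.
Proof. by move=> mB; rewrite fineK// fin_num_measure. Qed.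

Lemma prob_le1 B : measurable B -> prob B <= 1.
Proof. by move=> mB; rewrite -lee_fin EFin_prob// probability_le1. Qed.

Lemma prob_setT : prob setT = 1.
Proof. by rewrite /prob probability_setT. Qed.

Lemma prob_set0 : prob set0 = 0.
Proof. by rewrite /prob measure0. Qed.

Lemma prob_subset B C : measurable B -> measurable C -> B `<=` C ->
  prob B <= prob C.
Proof.
by move=> mB mC BC; rewrite -lee_fin !EFin_prob//; apply: le_measure; rewrite ?inE.
Qed.

Lemma prob_setU_le B C : measurable B -> measurable C ->
  prob (B `|` C) <= prob B + prob C.
Proof.
move=> mB mC; rewrite -lee_fin EFinD !EFin_prob//; last exact: measurableU.
exact: measureU2.
Qed.

Lemma prob_setU B C : measurable B -> measurable C ->
  prob (B `|` C) = prob B + prob C - prob (B `&` C).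
Proof.
move=> mB mC; apply: EFin_inj.
rewrite EFinB EFinD !EFin_prob//; [|exact: measurableI|exact: measurableU].
rewrite measureUfinl//.
by rewrite -ge0_fin_numE ?fin_num_measure.
Qed.

Lemma prob_setD B C : measurable B -> measurable C ->
  prob (B `\` C) = prob B - prob (B `&` C).
Proof.
move=> mB mC; apply: EFin_inj.
rewrite EFinB !EFin_prob//; [|exact: measurableI|exact: measurableD].
rewrite measureD//.
by rewrite -ge0_fin_numE ?fin_num_measure.
Qed.

Lemma prob_setC B : measurable B -> prob (~` B) = 1 - prob B.
Proof.
by move=> mB; rewrite -setTD prob_setD// prob_setT setTI.
Qed.

Definition nat_measurable Z := forall A, measurable (Z @^-1` A).

Lemma prob_partition Z B n : nat_measurable Z -> measurable B ->
  \sum_(k < n) prob (B `&` Z @^-1` [set (k : nat)]) =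
  prob (B `&` [set w | (Z w < n)%N]).
Proof.
move=> mZ mB; elim: n => [|n IH].
  rewrite big_ord0 (_ : [set w | _] = set0) ?setI0 ?prob_set0//.
  by apply/seteqP; split.
rewrite big_ord_recr/= IH.
have mA k : measurable [set w | (Z w < k)%N] by exact: (mZ [set i | (i < k)%N]).
have -> : B `&` [set w | (Z w < n.+1)%N] =
    (B `&` [set w | (Z w < n)%N]) `|` (B `&` Z @^-1` [set n]).
  rewrite -setIUr; congr (_ `&` _); apply/seteqP; split => w /=.
    by rewrite ltnS leq_eqVlt => /orP[/eqP|]; [right|left].
  by case=> [/ltnW|->].
rewrite prob_setU; [|exact: measurableI|exact: measurableI].
rewrite (_ : _ `&` (B `&` _) = set0) ?prob_set0 ?subr0//.
by apply/seteqP; split => w // [[_ /=] + [_ /= Zn]]; rewrite Zn ltnn.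
Qed.

Lemma prob_geq Z n : nat_measurable Z ->
  prob [set w | (n <= Z w)%N] = 1 - prob [set w | (Z w < n)%N].
Proof.
move=> mZ; rewrite -prob_setC; last exact: (mZ [set k | (k < n)%N]).
by congr (prob _); apply/seteqP; split => w /=; rewrite (leqNgt n) => /negP.
Qed.

Lemma prob_split Z n B : nat_measurable Z -> measurable B ->
  prob B = \sum_(k < n) prob (B `&` Z @^-1` [set (k : nat)]) +
           prob (B `&` [set w | (n <= Z w)%N]).
Proof.
move=> mZ mB; rewrite prob_partition//.
have mn : measurable [set w | (Z w < n)%N] by exact: (mZ [set k | (k < n)%N]).
rewrite (_ : [set w | (n <= _)%N] = ~` [set w | (Z w < n)%N]); last first.
  by apply/seteqP; split => w /=; rewrite (leqNgt n) => /negP.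
by rewrite -setDE prob_setD// addrC subrK.
Qed.

Definition indep_maps (Z1 Z2 : T -> nat) := forall A B : set nat,
  prob (Z1 @^-1` A `&` Z2 @^-1` B) = prob (Z1 @^-1` A) * prob (Z2 @^-1` B).

Definition nat_tail Z (x : R) : R := prob [set w | x < (Z w)%:R].

Lemma nat_measurable_gt Z (x : R) : nat_measurable Z ->
  measurable [set w | x < (Z w)%:R].
Proof. by move=> mZ; exact: (mZ [set k | x < k%:R]). Qed.

Lemma tail_realRV (Z : {RV P >-> nat}) x : tail (realRV Z) x = nat_tail Z x.
Proof.
rewrite /tail /nat_tail /prob /ccdf /distribution /pushforward.
congr (fine (P _)); apply/seteqP; split => w /=.
  by rewrite in_itv/= andbT.
by rewrite in_itv/= andbT.
Qed.

Lemma nat_measurableRV (Z : {RV P >-> nat}) : nat_measurable Z.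
Proof.
by move=> A; rewrite -[X in measurable X]setTI; exact: measurable_funP.
Qed.

(** The expectation splits over the fibres of [Z]. *)
Lemma expectation_nat (Z : {RV P >-> nat}) (g : nat -> R) :
  (forall k, 0 <= g k) ->
  ('E_P[fun w => g (Z w)])%E =
  (\sum_(k <oo) (g k * prob (Z @^-1` [set k]))%:E)%E.
Proof.
move=> g0; rewrite unlock.
have mZ := nat_measurableRV Z.
have UZ : \bigcup_k (Z @^-1` [set k]) = setT.
  by apply/seteqP; split => // w _; exists (Z w).
have mg : measurable_fun [set: T] (EFin \o (g \o Z)).
  apply/measurable_EFinP.
  by apply: (measurableT_comp (f := g : nat -> R)).
rewrite -UZ ge0_integral_bigcup//=; last 3 first.
- by rewrite UZ; exact: mg.
- by move=> w _; rewrite lee_fin.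
- apply/trivIsetP => i j _ _ ij; apply/seteqP; split => w // [/= -> /eqP].
  by rewrite (negbTE ij).
apply: eq_eseriesr => k _.
rewrite (eq_integral (cst (g k)%:E)); last by move=> w /[!inE] /= ->.
by rewrite integral_cst ?mZ//= EFinM EFin_prob.
Qed.

Definition pmf Z (k : nat) : R := prob (Z @^-1` [set k]).

Lemma pmf_ge0 Z k : 0 <= pmf Z k.
Proof. exact: prob_ge0. Qed.

Lemma sum_pmf Z n : nat_measurable Z ->
  \sum_(k < n) pmf Z k = prob [set w | (Z w < n)%N].
Proof.
move=> mZ; rewrite -[X in prob X]setTI -prob_partition//.
by apply: eq_bigr => k _; rewrite setTI.
Qed.

Lemma sum_pmf_le1 Z n : nat_measurable Z -> \sum_(k < n) pmf Z k <= 1.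
Proof.
move=> mZ; rewrite sum_pmf//; apply: prob_le1.
exact: (mZ [set k | (k < n)%N]).
Qed.

Lemma moment_partial_sum (Z : {RV P >-> nat}) (r : R) : finite_moment Z r ->
  exists M, forall n, \sum_(k < n) k%:R `^ r * pmf Z k <= M.
Proof.
rewrite /finite_moment.
have -> := expectation_nat Z (fun k => powR_ge0 k%:R r) => hM.
exists (fine (\sum_(k <oo) (k%:R `^ r * prob (Z @^-1` [set k]))%:E)%E) => n.
rewrite -lee_fin fineK; last first.
  rewrite ge0_fin_numE//; apply: nneseries_ge0 => k _ _.
  by rewrite lee_fin mulr_ge0 ?powR_ge0 ?prob_ge0.
rewrite -sumEFin -(big_mkord xpredT (fun k => (k%:R `^ r * pmf Z k)%:E)).
by apply: nneseries_lim_ge => k _ _; rewrite lee_fin mulr_ge0 ?powR_ge0 ?prob_ge0.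
Qed.

Lemma mean_fin_num (Z : {RV P >-> nat}) (r : R) : 1 < r -> finite_moment Z r ->
  ('E_P[realRV Z])%E \is a fin_num.
Proof.
move=> r1 /moment_partial_sum [M hM].
have le_r k : k%:R <= k%:R `^ r :> R.
  case: k => [|k]; first by rewrite powR_ge0.
  by rewrite -[leLHS]powRr1// ler_powR// ?ler1n// ltW.
have ge0 k : (0 <= (k%:R * pmf Z k)%:E)%E.
  by rewrite lee_fin mulr_ge0// prob_ge0.
have -> := expectation_nat Z (fun k => ler0n R k).
rewrite ge0_fin_numE; last by apply: nneseries_ge0 => k _ _; exact: ge0.
apply: (@le_lt_trans _ _ M%:E); last by rewrite ltry.
apply: lime_le; first by apply: is_cvg_nneseries => k _ _; exact: ge0.
near=> n; rewrite sumEFin lee_fin big_mkord.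
apply: le_trans (hM n); apply: ler_sum => k _.
by rewrite ler_wpM2r// prob_ge0.
Unshelve. all: by end_near. Qed.

(** Needed because the deviation bounds work with finite sums over the step law,
and have to reach [mean Z] by truncation. *)
Lemma mean_series (Z : {RV P >-> nat}) (r : R) : 1 < r -> finite_moment Z r ->
  \sum_(k < n) k%:R * pmf Z k @[n --> \oo] --> mean Z.
Proof.
move=> r1 hM; have := mean_fin_num r1 hM.
rewrite /mean; have -> := expectation_nat Z (fun k => ler0n R k).
set u := fun k => (k%:R * prob (Z @^-1` [set k]))%:E => fin.
have : cvgn (fun n => \sum_(0 <= k < n) u k)%E.
  by apply: is_cvg_nneseries => k _ _; rewrite /u lee_fin mulr_ge0// prob_ge0.
rewrite -(fineK fin) => /fine_cvg.
under eq_fun do rewrite /= sumEFin/= big_mkord.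
exact.
Qed.

(** Markov's inequality at level 1. *)
Lemma mean_gt0 (Z : {RV P >-> nat}) (r : R) : 1 < r -> finite_moment Z r ->
  (P [set w | Z w = 0%N] < 1)%E -> 0 < mean Z.
Proof.
move=> r1 hM hZ; have Efin := mean_fin_num r1 hM.
have mZ := nat_measurableRV Z.
rewrite -lte_fin /mean fineK//.
have Z0 : (0 < P [set w | (0 < Z w)%N])%E.
  rewrite (_ : [set w | _] = ~` [set w | Z w = 0%N]); last first.
    by apply/seteqP; split => w /=; rewrite lt0n => /eqP.
  rewrite probability_setC; last exact: (mZ [set 0%N]).
  by rewrite sube_gt0.
apply: (lt_le_trans Z0).
have := @markov _ _ _ P (realRV Z) id 1 ltr01.
rewrite mul1e (_ : [set w | _] = [set w | (0 < Z w)%N]); last first.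
  by apply/seteqP; split => w /=; rewrite lee_fin ger0_norm ?ler0n// ler1n.
rewrite (_ : id \o _ \o _ = realRV Z); first by apply.
by apply/funext => w /=; rewrite ger0_norm// ler0n.
Qed.

Lemma nat_tail_le_moment (Z : {RV P >-> nat}) (r : R) :
  0 < r -> finite_moment Z r ->
  exists2 M, 0 <= M & forall x, 0 < x -> nat_tail Z x <= M * x `^ (- r).
Proof.
move=> r0 hM; have Ege0 : (0 <= 'E_P[fun w => (realRV Z w `^ r)%R])%E.
  by apply: expectation_ge0 => w; exact: powR_ge0.
exists (fine ('E_P[fun w => (realRV Z w `^ r)%R])%E); first exact: fine_ge0.
move=> x x0; have mZ := nat_measurableRV Z.
have := @markov _ _ _ P (realRV Z) (fun y => y `^ r) x x0.
rewrite (_ : _ \o _ \o _ = (fun w => (realRV Z w `^ r)%R)); last first.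
  by apply/funext => w /=; rewrite ger0_norm// ler0n.
move=> /(_ _ _ _)/(le_trans _) => H.
rewrite powRN ler_pdivlMr ?powR_gt0// mulrC -lee_fin EFinM.
rewrite EFin_prob; last exact: nat_measurable_gt.
rewrite fineK; last by rewrite ge0_fin_numE//; exact: hM.
apply: H.
- apply: lee_pmul; rewrite ?lee_fin ?powR_ge0//.
  apply: le_measure; rewrite ?inE.
  + exact: nat_measurable_gt.
  + rewrite (_ : [set w | _] = Z @^-1` [set k | (x%:E <= `|(k%:R : R)%:E|)%E])//.
  + by move=> w /=; rewrite lee_fin ger0_norm ?ler0n// => /ltW.
- exact: measurable_powR.
- by move=> y _; exact: powR_ge0.
- by move=> y z; rewrite !nnegrE => y0 z0 yz; apply: ge0_ler_powR => //; exact: ltW.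
Qed.

End real_probability.

(** * Exponential bounds for partial sums *)

Section partial_sums.
Context d (T : measurableType d) (R : realType) (P : probability T R).

Definition partial_sum (xi : nat -> T -> nat) (j : nat) (w : T) : nat :=
  (\sum_(i < j) xi i w)%N.

(** Exactly what the Chernoff recursions use: a common law [p], and each step
independent of the sum of the previous ones. *)
Record iid_steps (xi : nat -> T -> nat) (p : nat -> R) : Prop := {
  step_measurable : forall i, nat_measurable (xi i) ;
  partial_sum_measurable : forall j, nat_measurable (partial_sum xi j) ;
  step_law : forall i k, pmf P (xi i) k = p k ;
  step_indep : forall j, indep_maps P (partial_sum xi j) (xi j) }.

Context (xi : nat -> T -> nat) (p : nat -> R).
Hypothesis iid : iid_steps xi p.

Let mxi := step_measurable iid.
Let mU := partial_sum_measurable iid.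

Lemma partial_sum0 w : partial_sum xi 0 w = 0%N.
Proof. by rewrite /partial_sum big_ord0. Qed.

Lemma partial_sumS j w : partial_sum xi j.+1 w = (partial_sum xi j w + xi j w)%N.
Proof. by rewrite /partial_sum big_ord_recr. Qed.

Lemma partial_sum_homo j k w : (j <= k)%N ->
  (partial_sum xi j w <= partial_sum xi k w)%N.
Proof.
move=> /subnK <-; elim: (k - j)%N => [//|i IH].
by rewrite addSn partial_sumS; exact: leq_trans IH (leq_addr _ _).
Qed.

Lemma law_ge0 k : 0 <= p k.
Proof. by rewrite -(step_law iid 0%N); exact: pmf_ge0. Qed.

Lemma sum_law_le1 n : \sum_(k < n) p k <= 1.
Proof.
under eq_bigr do rewrite -(step_law iid 0%N).
by apply: sum_pmf_le1; exact: mxi.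
Qed.

Lemma prob_step_ge j n :
  prob P [set w | (n <= xi j w)%N] = 1 - \sum_(k < n) p k.
Proof.
under eq_bigr do rewrite -(step_law iid j).
by rewrite sum_pmf ?prob_geq//; exact: mxi.
Qed.

(** A step of size at least [n] is paid for by its probability, at most [j] times;
conditioning on the value of the last step when it is smaller than [n] gives a
recursion in [j] for which the exponential bound is stable. The generating
function is thus truncated and finite for every [lam]. *)
Lemma chernoff_upper (lam : R) n j s : 0 <= lam ->
  nat_tail P (partial_sum xi j) s <=
  j%:R * (1 - \sum_(k < n) p k) +
  expR (- (lam * s)) * (\sum_(k < n) expR (lam * k%:R) * p k) ^+ j.
Proof.
move=> lam0; set tau := 1 - _; set phi := \sum_(k < n) _.
have phi0 : 0 <= phi.
  by apply: sumr_ge0 => k _; rewrite mulr_ge0 ?expR_ge0 ?law_ge0.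
elim: j s => [|j IH] s.
  rewrite mul0r add0r expr0 mulr1.
  have [s0|s0] := ltP s 0.
    apply: (le_trans (prob_le1 _ _)); first exact/nat_measurable_gt/mU.
    by rewrite -expR0 ler_expR oppr_ge0 mulr_ge0_le0// ltW.
  rewrite /nat_tail (_ : [set w | _] = set0) ?prob_set0 ?expR_ge0//.
  apply/seteqP; split => w //=; rewrite partial_sum0 => /(le_lt_trans s0).
  by rewrite ltxx.
rewrite /nat_tail; set B := [set w | _].
have mB : measurable B by exact/nat_measurable_gt/mU.
rewrite (prob_split P n (mxi j) mB).
have -> : j.+1%:R * tau + expR (- (lam * s)) * phi ^+ j.+1 =
    (j%:R * tau + expR (- (lam * s)) * phi ^+ j.+1) + tau by rewrite -natr1; ring.
apply: lerD; last first.
  rewrite /tau -(prob_step_ge j); apply: prob_subset; last by move=> w [].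
  - by apply: measurableI => //; exact: (mxi j [set k | (n <= k)%N]).
  - exact: (mxi j [set k | (n <= k)%N]).
apply: (@le_trans _ _ (\sum_(k < n)
    (j%:R * tau + expR (- (lam * (s - k%:R))) * phi ^+ j) * p k)).
  apply: ler_sum => k _.
  apply: (@le_trans _ _ (nat_tail P (partial_sum xi j) (s - k%:R) * p k)); last first.
    by rewrite ler_wpM2r ?law_ge0.
  rewrite -(step_law iid j) /nat_tail -(step_indep iid j [set i | s - k%:R < i%:R]).
  apply: prob_subset.
  - by apply: measurableI => //; exact: mxi.
  - by apply: measurableI; [exact: (mU _ [set i | s - k%:R < i%:R])|exact: mxi].
  - move=> w [/= + xk]; rewrite /B/= partial_sumS xk natrD => h; split => //=.
    by rewrite ltrBlDr.
under eq_bigr do rewrite mulrDl.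
rewrite big_split/= -mulr_sumr; apply: lerD.
  rewrite ler_piMr// ?sum_law_le1// mulr_ge0// /tau -(prob_step_ge j).
  exact: prob_ge0.
rewrite exprSr {2}/phi mulrA mulr_sumr; apply: ler_sum => k _.
rewrite mulrBr opprB expRD le_eqVlt; apply/orP; left; apply/eqP; ring.
Qed.

(** Steps of size at least [n] are counted as 0, which can only make a small sum
more likely; the base of the power is the Laplace transform of that truncation. *)
Lemma chernoff_lower (lam : R) n j s : 0 <= lam ->
  prob P [set w | (partial_sum xi j w)%:R <= s] <=
  expR (lam * s) *
  (1 - \sum_(k < n) (1 - expR (- (lam * k%:R))) * p k) ^+ j.
Proof.
move=> lam0; set psi := 1 - _.
have psiE : psi =
    \sum_(k < n) expR (- (lam * k%:R)) * p k + (1 - \sum_(k < n) p k).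
  rewrite /psi; under eq_bigr do rewrite mulrBl mul1r.
  by rewrite big_split/= sumrN; ring.
have psi0 : 0 <= psi.
  rewrite psiE addr_ge0 ?subr_ge0 ?sum_law_le1//.
  by apply: sumr_ge0 => k _; rewrite mulr_ge0 ?expR_ge0 ?law_ge0.
elim: j s => [|j IH] s.
  rewrite expr0 mulr1.
  have [s0|s0] := leP 0 s.
    apply: (le_trans (prob_le1 _ _)); first exact: (mU _ [set i | i%:R <= s]).
    by rewrite -expR0 ler_expR mulr_ge0.
  rewrite (_ : [set w | _] = set0) ?prob_set0 ?expR_ge0//.
  apply/seteqP; split => w //=; rewrite partial_sum0 => /le_lt_trans/(_ s0).
  by rewrite ltxx.
set B := [set w | _].
have mB : measurable B by exact: (mU _ [set i | i%:R <= s]).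
rewrite (prob_split P n (mxi j) mB).
have -> : expR (lam * s) * psi ^+ j.+1 =
   \sum_(k < n) (expR (lam * (s - k%:R)) * psi ^+ j) * p k +
   (expR (lam * s) * psi ^+ j) * (1 - \sum_(k < n) p k).
  rewrite exprSr {2}psiE mulrA [LHS]mulrDr; congr (_ + _).
  rewrite mulr_sumr; apply: eq_bigr => k _.
  by rewrite mulrBr expRD; ring.
apply: lerD; last first.
  rewrite -(prob_step_ge j).
  apply: le_trans (ler_wpM2r (prob_ge0 _ _) (IH s)).
  rewrite -(step_indep iid j [set i | i%:R <= s] [set i | (n <= i)%N]).
  apply: prob_subset.
  - by apply: measurableI => //; exact: (mxi j [set k | (n <= k)%N]).
  - apply: measurableI; first exact: (mU _ [set i | i%:R <= s]).
    exact: (mxi j [set k | (n <= k)%N]).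
  - move=> w [/= + xk]; rewrite /B/= partial_sumS natrD => h; split => //=.
    by apply: le_trans h; rewrite lerDl.
apply: ler_sum => k _.
apply: le_trans (ler_wpM2r (law_ge0 _) (IH (s - k%:R))).
rewrite -(step_law iid j) -(step_indep iid j [set i | i%:R <= s - k%:R]).
apply: prob_subset.
- by apply: measurableI => //; exact: mxi.
- by apply: measurableI; [exact: (mU _ [set i | i%:R <= s - k%:R])|exact: mxi].
- move=> w [/= + xk]; rewrite /B/= partial_sumS xk natrD => h; split => //=.
  by rewrite lerBrDr.
Qed.

End partial_sums.

(** * Deviations of partial sums from their mean *)

Section exponential_inequalities.
Context {R : realType}.
Implicit Types u : R.

Lemma expRN_le u : 0 <= u -> u / (1 + u) <= 1 - expR (- u).
Proof.
move=> u0; have u1 : 0 < 1 + u by rewrite ltr_pwDl.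
have h : expR (- u) <= (1 + u)^-1.
  by rewrite expRN lef_pV2 ?posrE ?expR_gt0// expR_ge1Dx.
have -> : u / (1 + u) = 1 - (1 + u)^-1; last by lra.
by field; rewrite gt_eqF.
Qed.

(** With only [p] moments available, the second-order remainder of the
exponential has to be controlled by [u `^ p] instead of [u ^+ 2]. *)
Lemma expR_le_powR u (p : R) : 0 <= u -> 1 <= p <= 2 ->
  expR u <= 1 + u + u `^ p * expR u.
Proof.
move=> u0 /andP[p1 p2].
have eu0 : 0 <= expR u by exact: expR_ge0.
have h1 : expR u - 1 <= u * expR u.
  have : 1 - u <= expR (- u) by rewrite -[1 - u]/(1 + - u) expR_ge1Dx.
  move=> /(ler_wpM2r eu0); rewrite -expRD addNr expR0; lra.
have [u1|u1] := leP u 1.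
  have : u ^+ 2 <= u `^ p.
    rewrite -powR_mulrn//.
    have [->|u_neq0] := eqVneq u 0.
      by rewrite !powR0// gt_eqF// (lt_le_trans _ p1).
    by rewrite ger_powR// lt_def u_neq0 u0.
  move=> /(ler_wpM2r eu0).
  have := ler_wpM2l u0 h1; lra.
have : 1 <= u `^ p.
  by rewrite -(powRr0 u); apply: ler_powR; [exact: ltW|exact: le_trans p1].
move=> /(ler_wpM2r eu0); lra.
Qed.

Lemma ln_le_powR (x k : R) : 1 <= x -> 0 < k -> ln x <= x `^ k / k.
Proof.
move=> x1 k0; rewrite ler_pdivlMr// mulrC -ln_powR.
have xk0 : 0 < x `^ k by rewrite powR_gt0// (lt_le_trans ltr01).
have : ln (1 + (x `^ k - 1)) <= x `^ k - 1 by apply: le_ln1Dx; lra.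
rewrite addrC subrK; lra.
Qed.

End exponential_inequalities.

Section large_deviations.
Context d (T : measurableType d) (R : realType) (P : probability T R).
Context (xi : nat -> T -> nat) (p : nat -> R).
Hypothesis iid : iid_steps P xi p.

(** Truncating the steps at a level [L] keeps a mean [b > a]; for small [lam] the
Laplace transform of the truncated step beats [expR (- lam * a)]. *)
Lemma lower_deviation (m a : R) :
  \sum_(k < n) k%:R * p k @[n --> \oo] --> m -> 0 <= a < m ->
  exists2 c, 0 < c & forall j s, s <= a * j%:R ->
    prob P [set w | (partial_sum xi j w)%:R <= s] <= expR (- (c * j%:R)).
Proof.
move=> cvm /andP[a0 am].
have [L hL] : exists L, (a + m) / 2 <= \sum_(k < L) k%:R * p k.
  have : \forall n \near \oo, (a + m) / 2 <= \sum_(k < n) k%:R * p k.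
    by apply: (cvgr_ge m cvm); lra.
  by case=> n _ /(_ n (leqnn n)); exists n.
set b := (a + m) / 2 in hL.
have ab : a < b by rewrite /b; lra.
have L0 : 0 <= L%:R :> R by exact: ler0n.
(* This step size makes [a * lam * L < b - a], that is
   [a < b / (1 + lam * L)]. *)
pose lam := (b - a) / ((a + 1) * (L%:R + 1)).
have D0 : 0 < (a + 1) * (L%:R + 1) by rewrite mulr_gt0//; lra.
have lam0 : 0 < lam by rewrite /lam divr_gt0// subr_gt0.
have lamD : lam * ((a + 1) * (L%:R + 1)) = b - a by rewrite /lam divfK// gt_eqF.
have lamL : 0 <= lam * L%:R by rewrite mulr_ge0// ltW.
have lL1 : 0 < 1 + lam * L%:R by rewrite ltr_pwDl.
pose c := lam * (b / (1 + lam * L%:R) - a).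
have c0 : 0 < c.
  rewrite mulr_gt0// subr_gt0 ltr_pdivlMr//.
  have : 0 <= lam * a by rewrite mulr_ge0// ltW.
  nra.
exists c => // j s sa.
apply: le_trans (chernoff_lower iid L j s (ltW lam0)) _.
set psi := 1 - _.
have psi0 : 0 <= psi.
  rewrite subr_ge0; apply: le_trans (sum_law_le1 iid L).
  apply: ler_sum => k _; apply: ler_piMl; first exact: (law_ge0 iid).
  by have := expR_ge0 (- (lam * k%:R)); lra.
have psi_le : psi <= expR (- (lam * (b / (1 + lam * L%:R)))).
  apply: le_trans (expR_ge1Dx _); rewrite lerD2l lerN2.
  apply: (@le_trans _ _ (\sum_(k < L) (lam / (1 + lam * L%:R)) * (k%:R * p k))).
    rewrite -mulr_sumr mulrA mulrAC ler_wpM2l// divr_ge0// ltW//.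
  apply: ler_sum => k _; rewrite mulrA ler_wpM2r ?(law_ge0 iid)//.
  have lk0 : 0 <= lam * k%:R by rewrite mulr_ge0// ltW.
  apply: le_trans (expRN_le lk0).
  rewrite mulrAC ler_wpM2l// lef_pV2 ?posrE ?ltr_pwDl//.
  by rewrite lerD2l ler_wpM2l ?ler_nat ?(ltnW (ltn_ord k))// ltW.
apply: (@le_trans _ _ (expR (lam * (a * j%:R)) *
    expR (- (lam * (b / (1 + lam * L%:R)))) ^+ j)).
  apply: ler_pM; rewrite ?expR_ge0 ?exprn_ge0//.
    by rewrite ler_expR ler_wpM2l// ltW.
  by rewrite lerXn2r// ?nnegrE ?expR_ge0.
rewrite -expRM_natl -expRD ler_expR le_eqVlt; apply/orP; left; apply/eqP.
by rewrite /c; ring.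
Qed.

(** Truncate the steps at [eta * x] and take [lam = r * ln x / (del * x)], so that
the margin [del = 1 - q * m] below the mean yields
[expR (- lam * del * x) = x `^ (- r)]. The truncation level is chosen so that
[expR (lam * (eta * x))] is the small power [x `^ ((e - 1) / 2)], which keeps the
remainder term bounded for the exponent [e = Num.min r 2 > 1]. One step above [eta * x]
costs at most [j] times a multiple of [x `^ (- r)]. *)
Lemma upper_deviation (m r M M' q : R) : 1 < r -> 0 < m ->
  (forall n, \sum_(k < n) k%:R * p k <= m) ->
  (forall n, \sum_(k < n) k%:R `^ r * p k <= M) ->
  0 <= M' -> (forall x, 0 < x -> nat_tail P (xi 0%N) x <= M' * x `^ (- r)) ->
  0 < q -> q * m < 1 ->
  exists2 C, 0 <= C & forall x j, 1 <= x -> j%:R <= q * x ->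
    nat_tail P (partial_sum xi j) x <= C * (j%:R + 1) * x `^ (- r).
Proof.
move=> r1 m0 hm hM M'0 htail q0 qm.
have r0 : 0 < r by lra.
pose e := Num.min r 2.
have e1 : 1 < e by rewrite lt_min r1; lra.
have e12 : 1 <= e <= 2 by rewrite (ltW e1)/= ge_min lexx orbT.
have e0 : 0 < e by lra.
have er : e <= r by rewrite ge_min lexx.
pose del := 1 - q * m.
have del0 : 0 < del by rewrite subr_gt0.
pose eta := del * (e - 1) / (2 * r).
have eta0 : 0 < eta by rewrite divr_gt0 ?mulr_gt0// subr_gt0.
(* The logarithm in [lam] is absorbed by [ln x <= x `^ kap / kap]. *)
pose kap := (e - 1) / (2 * e).
have kap0 : 0 < kap by rewrite divr_gt0 ?mulr_gt0// subr_gt0.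
have M0 : 0 <= M by have := hM 0%N; rewrite big_ord0.
pose E := (r / (del * kap)) `^ e.
have E0 : 0 <= E by exact: powR_ge0.
have rdk0 : 0 <= r / (del * kap) by rewrite ltW// divr_gt0// mulr_gt0.
pose C := M' * eta `^ (- r) + expR (q * M * E).
have C0 : 0 <= C by rewrite addr_ge0 ?mulr_ge0 ?powR_ge0 ?expR_ge0.
exists C => // x j x1 jx.
have x0 : 0 < x by lra.
have xD a b : x `^ (a + b) = x `^ a * x `^ b.
  by apply: powRD; apply/implyP => _; rewrite gt_eqF.
pose lam := r * ln x / (del * x).
have lnx0 : 0 <= ln x by exact: ln_ge0.
have lam0 : 0 <= lam by rewrite divr_ge0 ?mulr_ge0// ltW.
have ex0 : 0 < eta * x by rewrite mulr_gt0.
pose n := (Num.truncn (eta * x)).+1.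
apply: le_trans (chernoff_upper iid n j x lam0) _.
have -> : 1 - \sum_(k < n) p k = nat_tail P (xi 0%N) (eta * x).
  rewrite -(prob_step_ge iid 0%N) /nat_tail; congr (prob P _).
  by apply/seteqP; split => w /=; rewrite /n truncn_lt_nat// ltW.
have jr0 : 0 <= j%:R :> R by exact: ler0n.
have big_jump : j%:R * nat_tail P (xi 0%N) (eta * x) <=
    M' * eta `^ (- r) * (j%:R + 1) * x `^ (- r).
  apply: (@le_trans _ _ (j%:R * (M' * (eta * x) `^ (- r)))).
    by rewrite ler_wpM2l// htail.
  rewrite powRM ?(ltW eta0) ?(ltW x0)//.
  have -> : M' * eta `^ (- r) * (j%:R + 1) * x `^ (- r) =
      j%:R * (M' * (eta `^ (- r) * x `^ (- r))) +
      M' * eta `^ (- r) * x `^ (- r) by ring.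
  by rewrite lerDl !mulr_ge0 ?powR_ge0.
have lamE : lam `^ e * expR (lam * (eta * x)) * x <= E.
  have lam_le : lam <= r / (del * kap) * x `^ (kap - 1).
    have := ln_le_powR x1 kap0 => hln.
    rewrite xD powR_inv1 ?(ltW x0)//.
    have -> : r / (del * kap) * (x `^ kap / x) = r * (x `^ kap / kap) / (del * x).
      by field; rewrite !gt_eqF.
    by rewrite ler_pM2r ?invr_gt0 ?mulr_gt0// ler_wpM2l// ltW.
  have ln_x : lam * (eta * x) = (e - 1) / 2 * ln x.
    by rewrite /lam /eta; field; rewrite !gt_eqF.
  have -> : expR (lam * (eta * x)) = x `^ ((e - 1) / 2).
    by rewrite ln_x /powR gt_eqF.
  apply: (@le_trans _ _ ((r / (del * kap) * x `^ (kap - 1)) `^ e *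
      x `^ ((e - 1) / 2) * x)).
    rewrite ler_wpM2r ?(ltW x0)// ler_wpM2r ?powR_ge0//.
    apply: ge0_ler_powR => //; rewrite ?nnegrE//; first exact: ltW.
    by rewrite mulr_ge0 ?powR_ge0.
  rewrite powRM; last 2 first.
    exact: rdk0.
    by rewrite powR_ge0.
  rewrite -powRrM -/E -!mulrA.
  have -> : x `^ ((kap - 1) * e) * (x `^ ((e - 1) / 2) * x) = 1.
    rewrite -{3}[x]powRr1 ?(ltW x0)// -!xD.
    rewrite (_ : _ + _ = 0) ?powRr0// /kap.
    by field; rewrite gt_eqF.
  by rewrite mulr1.
set phi := \sum_(k < n) _.
have phi0 : 0 <= phi.
  by apply: sumr_ge0 => k _; rewrite mulr_ge0 ?expR_ge0 ?(law_ge0 iid).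
have phi_le : phi <= expR (lam * m + lam `^ e * M * expR (lam * (eta * x))).
  apply: le_trans (expR_ge1Dx _).
  apply: (@le_trans _ _ (\sum_(k < n) (p k + lam * (k%:R * p k) +
      lam `^ e * expR (lam * (eta * x)) * (k%:R `^ r * p k)))).
    apply: ler_sum => k _; have pk0 := law_ge0 iid k.
    have k0 : 0 <= k%:R :> R by exact: ler0n.
    have lk0 : 0 <= lam * k%:R by rewrite mulr_ge0.
    have := expR_le_powR lk0 e12; rewrite powRM// => h.
    have hk : k%:R `^ e <= k%:R `^ r :> R.
      case: (nat_of_ord k) => [|i]; first by rewrite !powR0// gt_eqF.
      by rewrite ler_powR// ler1n.
    have hx : expR (lam * k%:R) <= expR (lam * (eta * x)).
      rewrite ler_expR ler_wpM2l//.
      by have := ltn_ord k; rewrite /n ltnS truncn_ge_nat// ltW.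
    have : lam `^ e * k%:R `^ e * expR (lam * k%:R) <=
           lam `^ e * k%:R `^ r * expR (lam * (eta * x)).
      by apply: ler_pM; rewrite ?mulr_ge0 ?powR_ge0 ?expR_ge0// ler_wpM2l ?powR_ge0.
    move=> h2; have {h2}h := le_trans h (lerD (lexx _) h2).
    have := ler_wpM2r pk0 h; lra.
  rewrite !big_split/= -!mulr_sumr addrA; apply: lerD.
    apply: lerD; first exact: (sum_law_le1 iid).
    apply: ler_wpM2l => //; exact: hm.
  rewrite [leRHS]mulrAC; apply: ler_wpM2l; last exact: hM.
  by rewrite mulr_ge0 ?powR_ge0 ?expR_ge0.
have chern : expR (- (lam * x)) * phi ^+ j <= expR (q * M * E) * x `^ (- r).
  set A := lam * m + _ in phi_le.
  have A0 : 0 <= A.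
    have m0' := ltW m0.
    apply: addr_ge0; first exact: mulr_ge0.
    by apply: mulr_ge0; rewrite ?expR_ge0// mulr_ge0 ?powR_ge0.
  apply: (@le_trans _ _ (expR (- (lam * x)) * expR A ^+ j)).
    by rewrite ler_wpM2l ?expR_ge0// lerXn2r// ?nnegrE ?expR_ge0.
  have -> : x `^ (- r) = expR (- r * ln x) by rewrite /powR gt_eqF.
  rewrite -expRM_natl -!expRD ler_expR.
  have jA : j%:R * A <= q * x * A by rewrite ler_wpM2r.
  have lx : lam * x * del = r * ln x.
    by rewrite /lam; field; rewrite !gt_eqF.
  have := ler_wpM2l (mulr_ge0 (ltW q0) M0) lamE.
  move: jA lx; rewrite /A /del; nra.
rewrite /C !mulrDl; apply: lerD => //.
apply: (le_trans chern); rewrite ler_wpM2r ?powR_ge0//.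
by rewrite ler_peMr ?expR_ge0// lerDr.
Qed.

End large_deviations.

(** * Functions comparable to a regularly varying one *)

Section asymptotics.
Context {R : realType}.
Implicit Types (F G H D h u psi : R -> R).

Lemma cvg_mulr_argument (q : R) : 0 < q -> (q * x) @[x --> +oo%R] --> +oo%R.
Proof. by move=> q0; apply: gt0_cvgMry => //; exact: cvg_id. Qed.

Lemma cvg_mul_argument h (q l : R) : 0 < q ->
  h x @[x --> +oo] --> l -> h (q * x) @[x --> +oo] --> l.
Proof.
move=> q0 hl; apply: (cvg_comp (fun x => q * x) h _ hl).
exact: cvg_mulr_argument.
Qed.

Lemma cvg_between (h : R -> R) (l : R) :
  (forall e, 0 < e -> \forall x \near +oo, h x <= l + e) ->
  (forall e, 0 < e -> \forall x \near +oo, l - e <= h x) ->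
  h x @[x --> +oo] --> l.
Proof.
move=> hup hlo; apply/cvgrPdist_le => e e0.
near=> x; rewrite ler_distlC; apply/andP; split; near: x.
  exact: hlo.
exact: hup.
Unshelve. all: by end_near. Qed.

(** If doubling the argument contracts [h] by a factor below 1, up to a vanishing
error, then [h] vanishes at infinity. It plays the role of a uniform bound of
Potter type for regularly varying functions. *)
Lemma cvg_doubling0 h (k e : R -> R) (q : R) :
  (forall x, 0 < x -> 0 <= h x) -> q < 1 ->
  k x @[x --> +oo] --> q -> e x @[x --> +oo] --> 0 ->
  (forall x, 0 < x -> h (2 * x) <= k x * h x + e x) ->
  (forall a, 0 < a -> exists B, forall x, a <= x <= 2 * a -> h x <= B) ->
  h x @[x --> +oo] --> 0.
Proof.
move=> h0 q1 kq e0 hrec hbnd.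
(* A contraction factor in ]0, 1[ above [q], even if [q] is negative. *)
pose t := (Num.max q 0 + 1) / 2.
have mx1 : Num.max q 0 < 1 by rewrite gt_max q1 ltr01.
have mx0 : 0 <= Num.max q 0 by rewrite le_max lexx orbT.
have mxq : q <= Num.max q 0 by rewrite le_max lexx.
have t0 : 0 < t by rewrite /t; lra.
have t1 : t < 1 by rewrite /t; lra.
have qt : q < t by rewrite /t; lra.
apply: cvg_between => eps eps0; last first.
  near=> x; rewrite sub0r; apply: (@le_trans _ _ 0); first lra.
  by apply: h0.
pose d := eps / 2.
have d0 : 0 < d by rewrite /d; lra.
have td0 : 0 < (1 - t) * d by rewrite mulr_gt0// subr_gt0.
have [a a0 [ka ea]] : exists2 a, 0 < a &
    (forall x, a <= x -> k x <= t) /\ (forall x, a <= x -> e x <= (1 - t) * d).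
  have [a1 [_ h1]] : \forall x \near +oo, k x <= t by exact: (cvgr_le q kq).
  have [a2 [_ h2]] : \forall x \near +oo, e x <= (1 - t) * d.
    exact: (cvgr_le 0 e0).
  exists (Num.max 1 (Num.max (a1 + 1) (a2 + 1))).
    by rewrite lt_max ltr01.
  split => x; rewrite !ge_max => /and3P[x1 x2 x3].
    by apply: h1; lra.
  by apply: h2; lra.
(* A bound [d + c] at [y / 2] improves to [d + t * c] at [y]. *)
have step c y : 0 <= c -> 2 * a <= y -> h (y / 2) <= d + c -> h y <= d + t * c.
  move=> c0 ay hy; have y0 : 0 < y / 2 by lra.
  have := hrec _ y0; rewrite mulrC divfK ?pnatr_eq0// => /le_trans; apply.
  have ay2 : a <= y / 2 by lra.
  have := ka _ ay2; have := ea _ ay2.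
  have hy0 := h0 _ y0.
  move=> he hk; have := ler_wpM2r hy0 hk; have := ler_wpM2l (ltW t0) hy; lra.
have [B0 hB0] := hbnd a a0.
pose B := Num.max B0 0.
have B_ge0 : 0 <= B by rewrite le_max lexx orbT.
(* A bound on [a, 2a] propagates to all larger arguments without growing. *)
have claim0 n y : a <= y <= 2 ^+ n.+1 * a -> h y <= d + B.
  elim: n y => [|n IH] y.
    rewrite expr1 => /hB0 hy; have : B0 <= B by rewrite le_max lexx.
    lra.
  move=> /andP[ay yn].
  have [y2|y2] := leP (2 * a) y; last first.
    by apply: IH; rewrite ay/=; apply: le_trans (ltW y2) _;
       rewrite ler_pM2r// -[leLHS]expr1 ler_eXn2l// ltr1n.
  apply: (@le_trans _ _ (d + t * B)).
    apply: step => //; apply: IH; apply/andP; split; first lra.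
    by move: yn; rewrite exprS; lra.
  by rewrite lerD2l ler_piMl// ltW.
(* Each further doubling gains a factor [t]. *)
have claim n y : 2 ^+ n * a <= y -> h y <= d + t ^+ n * B.
  elim: n y => [|n IH] y.
    rewrite expr0 !mul1r => ay.
    pose N := Num.truncn (y / a).
    apply: (claim0 N); rewrite ay/=.
    rewrite -ler_pdivrMr//; apply: (@le_trans _ _ N.+1%:R).
      by rewrite ltW// truncnS_gt.
    rewrite -natrX ler_nat; exact: ltnW (ltn_expl _ _).
  move=> ny; rewrite exprS -mulrA; apply: step.
  - by rewrite mulr_ge0// exprn_ge0// ltW.
  - apply: le_trans ny; rewrite exprS -mulrA ler_pM2l//.
    by rewrite ler_peMl ?(ltW a0)// exprn_ege1// ler1n.
  - by apply: IH; move: ny; rewrite exprS; lra.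
have [N tN] : exists N, t ^+ N * B <= d.
  have cvt : (t ^+ n * B) @[n --> \oo] --> (0 * B).
    by apply: cvgMr_tmp; apply: cvg_expr; rewrite ger0_norm// ltW.
  have [N _ /(_ N (leqnn N))] : \forall n \near \oo, t ^+ n * B <= d.
    by apply: (cvgr_le _ cvt); rewrite mul0r.
  by exists N.
near=> x; rewrite add0r; apply: (@le_trans _ _ (d + t ^+ N * B)).
  by apply: claim.
rewrite /d in tN *; lra.
Unshelve. all: by end_near. Qed.

Lemma cvg_powRN_pinfty (s : R) : 0 < s -> x `^ (- s) @[x --> +oo] --> (0 : R).
Proof.
move=> s0; apply: cvg_between => e e0; last first.
  by apply: nearW => x; rewrite sub0r (le_trans _ (powR_ge0 _ _))// oppr_le0 ltW.
near=> x; rewrite add0r.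
have z0 : 0 < e `^ (- s^-1) by rewrite powR_gt0.
have xz : e `^ (- s^-1) <= x by near: x; apply: nbhs_pinfty_ge; exact: num_real.
have x0 : 0 < x by exact: lt_le_trans xz.
rewrite powRN invf_ple ?posrE ?powR_gt0//.
have -> : e^-1 = (e `^ (- s^-1)) `^ s.
  by rewrite -powRrM mulNr mulVf ?gt_eqF// powR_inv1// ltW.
by apply: ge0_ler_powR; rewrite ?nnegrE ?(ltW s0) ?(ltW z0) ?(ltW x0).
Unshelve. all: by end_near. Qed.

Lemma continuous_powRl (s a : R) : 0 < a -> x `^ s @[x --> a] --> a `^ s.
Proof.
move=> a0.
have : derivable (fun x : R => x `^ s) a 1.
  by apply: derivable_powR; rewrite in_itv/= a0.
by move=> /derivable1_diffP/differentiable_continuous.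
Qed.

End asymptotics.

Section regular_variation.
Context {R : realType}.
Implicit Types (G H D u psi : R -> R).

Context (F : R -> R) (gamma : R).
Hypothesis F_gt0 : forall x, 0 < x -> 0 < F x.
Hypothesis F_rv : forall q, 0 < q ->
  F (q * x) / F x @[x --> +oo] --> q `^ (- gamma).

Lemma rescale_ratio H (c q : R) : 0 < q -> H x / F x @[x --> +oo] --> c ->
  H (q * x) / F x @[x --> +oo] --> c * q `^ (- gamma).
Proof.
move=> q0 Hc.
apply: cvg_trans (cvgM (cvg_mul_argument q0 Hc) (F_rv q0)).
apply: near_eq_cvg; near=> x.
have x0 : 0 < x by [].
by rewrite /= mulrA divfK// gt_eqF// F_gt0// mulr_gt0.
Unshelve. all: by end_near. Qed.

(** Both bounds are only available at scales [q] different from [q0]; since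
[q `^ (- gamma)] is continuous at [q0], they meet in the limit. *)
Lemma ratio_sandwich G H (c q0 : R) : 0 < q0 ->
  H x / F x @[x --> +oo] --> c ->
  (forall q, 0 < q < q0 -> exists2 u : R -> R, u x / F x @[x --> +oo] --> 0 &
     \forall x \near +oo, G x <= H (q * x) + u x) ->
  (forall q, q0 < q -> exists psi : R -> R, exists2 u : R -> R,
     psi x @[x --> +oo] --> (1 : R) /\ u x / F x @[x --> +oo] --> 0 &
     \forall x \near +oo, H (q * x) * psi x - u x <= G x) ->
  G x / F x @[x --> +oo] --> c * q0 `^ (- gamma).
Proof.
move=> q00 Hc Hup Hlo.
have cont : c * q `^ (- gamma) @[q --> q0] --> c * q0 `^ (- gamma).
  by apply: cvgMl_tmp; exact: continuous_powRl.
apply: cvg_between => e e0.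
  have [q [qq0 hq]] : exists q, 0 < q < q0 /\
      c * q `^ (- gamma) < c * q0 `^ (- gamma) + e.
    have : \forall q \near q0^'-, 0 < q < q0 /\
      c * q `^ (- gamma) < c * q0 `^ (- gamma) + e.
      near=> q; split.
        apply/andP; split; near: q; first exact: nbhs_left_gt.
        exact: nbhs_left_lt.
      near: q; apply: cvg_within.
      by apply: (cvgr_lt _ cont); lra.
    by move=> /filter_ex.
  have [u u0 hG] := Hup q qq0; have /andP[q_gt0 _] := qq0.
  have cvU : H (q * x) / F x + u x / F x @[x --> +oo] --> c * q `^ (- gamma).
    by rewrite -[X in _ --> X]addr0; apply: cvgD u0; exact: rescale_ratio.
  near=> x; have x0 : 0 < x by [].
  apply: (@le_trans _ _ (H (q * x) / F x + u x / F x)).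
    by rewrite -mulrDl ler_pM2r ?invr_gt0 ?F_gt0//; near: x.
  by near: x; exact: (cvgr_le _ cvU).
have [q [qq0 hq]] : exists q, q0 < q /\
    c * q0 `^ (- gamma) - e < c * q `^ (- gamma).
  have : \forall q \near q0^'+, q0 < q /\
    c * q0 `^ (- gamma) - e < c * q `^ (- gamma).
    near=> q; split; first by near: q; exact: nbhs_right_gt.
    near: q; apply: cvg_within.
    by apply: (cvgr_gt _ cont); lra.
  by move=> /filter_ex.
have [psi [u [psi1 u0] hG]] := Hlo q qq0; have q_gt0 := lt_trans q00 qq0.
have cvL : H (q * x) / F x * psi x - u x / F x @[x --> +oo] --> c * q `^ (- gamma).
  rewrite -[X in _ --> X]subr0 -[X in _ --> X - _]mulr1; apply: cvgB u0.
  by apply: cvgM psi1; exact: rescale_ratio.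
near=> x; have x0 : 0 < x by [].
apply: (@le_trans _ _ (H (q * x) / F x * psi x - u x / F x)).
  by near: x; exact: (cvgr_ge _ cvL).
by rewrite mulrAC -mulrBl ler_pM2r ?invr_gt0 ?F_gt0//; near: x.
Unshelve. all: by end_near. Qed.

Hypothesis F_noninc : forall x y, x <= y -> F y <= F x.

(** With [h x = x `^ (- r) * D x / F x], doubling [x] multiplies [h] by nearly
[2 `^ (gamma - r) < 1] and adds an error of order [x `^ (1 - r)]. *)
Lemma power_domination H D (c r : R) :
  1 < r -> gamma < r ->
  H x / F x @[x --> +oo] --> c ->
  (forall x, 0 < x -> 0 <= D x) -> (forall x y, x <= y -> D x <= D y) ->
  (forall x, 0 < x -> D (2 * x) <= D x + 2 * x * H x) ->
  x `^ (- r) * D x / F x @[x --> +oo] --> 0.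
Proof.
move=> r1 gr Hc D0 Dmono Drec.
have rF : F x / F (2 * x) @[x --> +oo] --> 2 `^ gamma.
  have -> : 2 `^ gamma = (2 `^ (- gamma))^-1 :> R by rewrite powRN invrK.
  have h2 : (F (2 * x) / F x)^-1 @[x --> +oo] --> (2 `^ (- gamma))^-1.
    by apply: cvgV; [rewrite gt_eqF ?powR_gt0|exact: F_rv].
  by under eq_fun do rewrite -invf_div.
have s0 : 0 < r - 1 by lra.
apply: (@cvg_doubling0 _ _ (fun x => 2 `^ (- r) * (F x / F (2 * x)))
    (fun x => 2 `^ (1 - r) * (x `^ (- (r - 1)) * (H x / F x) * (F x / F (2 * x))))
    (2 `^ (- r) * 2 `^ gamma)).
- by move=> x x0; rewrite !mulr_ge0 ?powR_ge0 ?D0// invr_ge0 ltW// F_gt0.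
- rewrite -powRD; last by rewrite pnatr_eq0 implybT.
  rewrite /powR pnatr_eq0/= expR_lt1 pmulr_llt0 ?ln_gt0 ?ltr1n//; lra.
- exact: cvgMl_tmp.
- have e0 : 2 `^ (1 - r) * (0 * c * 2 `^ gamma) = 0 by rewrite !(mul0r, mulr0).
  rewrite -[X in _ --> X]e0.
  apply: cvgMl_tmp; apply: cvgM => //; apply: cvgM => //.
  exact: cvg_powRN_pinfty.
- move=> x x0; have Fx := F_gt0 x0.
  have x20 : 0 < 2 * x by rewrite mulr_gt0.
  have F2x := F_gt0 x20.
  apply: (@le_trans _ _ ((2 * x) `^ (- r) * (D x + 2 * x * H x) / F (2 * x))).
    by rewrite ler_wpM2r ?invr_ge0 ?(ltW F2x)// ler_wpM2l ?powR_ge0// Drec.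
  rewrite powRM ?(ltW x0)//.
  have -> : 2 `^ (1 - r) = 2 * 2 `^ (- r) :> R.
    by rewrite powRD ?powRr1//; apply/implyP => _; rewrite pnatr_eq0.
  have -> : x `^ (- (r - 1)) = x * x `^ (- r).
    rewrite opprB powRD ?powRr1 ?(ltW x0)//.
    by apply/implyP => _; rewrite gt_eqF.
  rewrite le_eqVlt; apply/orP; left; apply/eqP; field.
  by rewrite !gt_eqF.
- move=> a a0; exists (a `^ (- r) * D (2 * a) / F (2 * a)) => x /andP[ax xa].
  have x0 := lt_le_trans a0 ax.
  have a20 : 0 < 2 * a by rewrite mulr_gt0.
  apply: ler_pM.
  + by rewrite mulr_ge0 ?powR_ge0 ?D0.
  + by rewrite invr_ge0 ltW// F_gt0.
  + apply: ler_pM; rewrite ?powR_ge0 ?D0// ?Dmono//.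
    rewrite !powRN lef_pV2 ?posrE ?powR_gt0//.
    by apply: ge0_ler_powR; rewrite ?nnegrE ?(ltW a0) ?(ltW x0)//; lra.
  + by rewrite lef_pV2 ?posrE ?F_gt0// F_noninc.
Qed.

End regular_variation.

(** * Tails of sums and of random sums *)

Section random_sums.
Context d (T : measurableType d) (R : realType) (P : probability T R).

Lemma nat_tail_truncn (Z : T -> nat) (x : R) : 0 <= x ->
  nat_tail P Z x = prob P [set w | ((Num.truncn x).+1 <= Z w)%N].
Proof.
move=> x0; rewrite /nat_tail; congr (prob P _).
by apply/seteqP; split => w /=; rewrite truncn_lt_nat.
Qed.

Lemma nat_tail_ge0 (Z : T -> nat) x : 0 <= nat_tail P Z x.
Proof. exact: prob_ge0. Qed.

(** This is [1 + E(Z; Z <= x)]: the 1 accounts for the [+ 1] of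
[upper_deviation], and makes [x `^ (- r)] itself negligible. *)
Definition truncated_mean (Z : T -> nat) (x : R) : R :=
  1 + \sum_(k < (Num.truncn x).+1) k%:R * pmf P Z k.

Lemma truncated_mean_ge0 Z x : 0 <= truncated_mean Z x.
Proof.
by rewrite addr_ge0// sumr_ge0// => k _; rewrite mulr_ge0// pmf_ge0.
Qed.

Lemma truncated_meanE Z x : truncated_mean Z x =
  1 + \sum_(0 <= k < (Num.truncn x).+1) k%:R * pmf P Z k.
Proof. by rewrite /truncated_mean big_mkord. Qed.

Lemma truncated_mean_homo Z x y : x <= y ->
  truncated_mean Z x <= truncated_mean Z y.
Proof.
move=> xy; rewrite !truncated_meanE lerD2l.
rewrite (big_cat_nat (n := (Num.truncn x).+1)
  (p := (Num.truncn y).+1))//=; last first.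
  by rewrite ltnS le_truncn.
by rewrite lerDl sumr_ge0// => k _; rewrite mulr_ge0// pmf_ge0.
Qed.

(** The values of [Z] between [x] and [2 * x] are at most [2 * x]. *)
Lemma truncated_mean_double Z x : nat_measurable Z -> 0 < x ->
  truncated_mean Z (2 * x) <= truncated_mean Z x + 2 * x * nat_tail P Z x.
Proof.
move=> mZ x0; rewrite !truncated_meanE.
have xx : (Num.truncn x <= Num.truncn (2 * x))%N by rewrite le_truncn//; lra.
rewrite (big_cat_nat (n := (Num.truncn x).+1) (p := (Num.truncn (2 * x)).+1))//=.
rewrite addrA lerD2l.
apply: (@le_trans _ _ (2 * x * \sum_((Num.truncn x).+1 <= k < (Num.truncn (2 * x)).+1)
    pmf P Z k)).
  rewrite mulr_sumr big_nat_cond [leRHS]big_nat_cond; apply: ler_sum => k.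
  rewrite andbT ltnS => /andP[_ kx]; rewrite ler_wpM2r ?pmf_ge0//.
  by move: kx; rewrite truncn_ge_nat//; lra.
rewrite ler_wpM2l//; first lra.
rewrite nat_tail_truncn ?(ltW x0)// prob_geq// -sum_pmf// lerBrDl.
rewrite -(big_mkord xpredT (pmf P Z)) -big_cat_nat//= big_mkord.
exact: sum_pmf_le1.
Qed.

Context (F : R -> R) (gamma : R).
Hypothesis F_gt0 : forall x, 0 < x -> 0 < F x.
Hypothesis F_rv : forall q, 0 < q ->
  F (q * x) / F x @[x --> +oo] --> q `^ (- gamma).
Hypothesis F_noninc : forall x y, x <= y -> F y <= F x.

Lemma truncated_mean_negligible (Z : T -> nat) (c r : R) : nat_measurable Z ->
  1 < r -> gamma < r -> nat_tail P Z x / F x @[x --> +oo] --> c ->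
  x `^ (- r) * truncated_mean Z x / F x @[x --> +oo] --> 0.
Proof.
move=> mZ r1 gr Zc; apply: (power_domination F_gt0 F_rv F_noninc r1 gr Zc).
- by move=> x _; exact: truncated_mean_ge0.
- exact: truncated_mean_homo.
- by move=> x; exact: truncated_mean_double.
Qed.

(** If the sum exceeds [x], then one summand exceeds [q * x] or both exceed
[(1 - q) * x]; conversely the sum exceeds [x] as soon as one summand does. *)
Lemma indep_sum_tail (A B : T -> nat) (a b : R) :
  nat_measurable A -> nat_measurable B ->
  nat_measurable (fun w => A w + B w)%N -> indep_maps P A B ->
  nat_tail P B x @[x --> +oo] --> 0 ->
  nat_tail P A x / F x @[x --> +oo] --> a ->
  nat_tail P B x / F x @[x --> +oo] --> b ->
  nat_tail P (fun w => A w + B w)%N x / F x @[x --> +oo] --> a + b.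
Proof.
move=> mA mB mAB indAB B0 Aa Bb.
have indE x y : prob P ([set w | x < (A w)%:R] `&` [set w | y < (B w)%:R]) =
    nat_tail P A x * nat_tail P B y.
  exact: (indAB [set k | x < k%:R] [set k | y < k%:R]).
have prod0 q : 0 < q ->
    nat_tail P A (q * x) * nat_tail P B (q * x) / F x @[x --> +oo] --> 0.
  move=> q0; have h : nat_tail P A (q * x) / F x * nat_tail P B (q * x)
      @[x --> +oo] --> a * q `^ (- gamma) * 0.
    by apply: cvgM; [exact: rescale_ratio|exact: cvg_mul_argument].
  rewrite mulr0 in h; apply: cvg_trans h; apply: near_eq_cvg.
  by apply: nearW => x; rewrite /= mulrAC.
pose H x := nat_tail P A x + nat_tail P B x.
have Hc : H x / F x @[x --> +oo] --> a + b.
  by rewrite /H; under eq_fun do rewrite mulrDl; exact: cvgD.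
(* Apply the sandwich at scale 1 to the sum of the two tails. *)
suff : nat_tail P (fun w => A w + B w)%N x / F x @[x --> +oo] -->
    (a + b) * 1 `^ (- gamma) by rewrite powR1 mulr1.
apply: (ratio_sandwich F_gt0 F_rv ltr01 Hc) => [q /andP[q0 q1]|q q1].
  exists (fun x => nat_tail P A ((1 - q) * x) * nat_tail P B ((1 - q) * x)).
    by apply: prod0; rewrite subr_gt0.
  near=> x; have x0 : 0 < x by [].
  rewrite -indE.
  have mgA (y : R) : measurable [set w | y < (A w)%:R] by exact: nat_measurable_gt.
  have mgB (y : R) : measurable [set w | y < (B w)%:R] by exact: nat_measurable_gt.
  have mI : measurable ([set w | (1 - q) * x < (A w)%:R] `&`
    [set w | (1 - q) * x < (B w)%:R]) by exact: measurableI.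
  apply: le_trans (lerD (prob_setU_le P (mgA (q * x)) (mgB (q * x))) (lexx _)).
  apply: le_trans (prob_setU_le P _ mI); last exact: measurableU.
  apply: prob_subset.
  - exact: nat_measurable_gt.
  - by apply: measurableU => //; exact: measurableU.
  - move=> w /=; rewrite natrD => xAB.
    have [|Aq] := ltP (q * x) (A w)%:R; first by left; left.
    have [|Bq] := ltP (q * x) (B w)%:R; first by left; right.
    right; split; lra.
exists (fun=> 1), (fun x => nat_tail P A x * nat_tail P B x).
  split; first exact: cvg_cst.
  by have := prod0 1 ltr01; under eq_fun do rewrite mul1r.
near=> x; have x0 : 0 < x by [].
have mgA (y : R) : measurable [set w | y < (A w)%:R] by exact: nat_measurable_gt.
have mgB (y : R) : measurable [set w | y < (B w)%:R] by exact: nat_measurable_gt.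
apply: (@le_trans _ _ (H x - nat_tail P A x * nat_tail P B x)).
  rewrite mulr1 lerD2r /H; apply: lerD; apply: prob_subset => // w /=.
    by apply: le_lt_trans; rewrite ler_peMl// ltW.
  by apply: le_lt_trans; rewrite ler_peMl// ltW.
rewrite -indE /H /nat_tail -prob_setU//.
apply: prob_subset.
- exact: measurableU.
- exact: nat_measurable_gt.
- move=> w /=; rewrite natrD => -[/lt_le_trans|/lt_le_trans]; apply.
    by rewrite lerDl.
  by rewrite lerDr.
Unshelve. all: by end_near. Qed.

Context (xi : nat -> T -> nat) (p : nat -> R).
Hypothesis iid : iid_steps P xi p.
Context (m r M M' : R).
Hypothesis m_gt0 : 0 < m.
Hypothesis r1 : 1 < r.
Hypothesis gr : gamma < r.
Hypothesis cvm : \sum_(k < n) k%:R * p k @[n --> \oo] --> m.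
Hypothesis hM : forall n, \sum_(k < n) k%:R `^ r * p k <= M.
Hypothesis M'0 : 0 <= M'.
Hypothesis htail : forall x, 0 < x -> nat_tail P (xi 0%N) x <= M' * x `^ (- r).

Lemma partial_mean_le n : \sum_(k < n) k%:R * p k <= m.
Proof.
have nd : nondecreasing_seq (fun n => \sum_(k < n) k%:R * p k).
  apply/nondecreasing_seqP => i; rewrite big_ord_recr/= lerDl mulr_ge0//.
  exact: (law_ge0 iid).
have := nondecreasing_cvgn_le nd (cvgP _ cvm) n.
by rewrite (cvg_lim _ cvm).
Qed.

(** Upper bound: either [N > q * x], or [N = j <= q * x] and the sum of [j] steps
makes an upper deviation. Lower bound: if [N > q * x], the sum contains the first
[K] steps, [K] being the least integer above [q * x]. *)
Lemma random_sum_tail (N : T -> nat) (c : R) : nat_measurable N ->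
  nat_measurable (fun w => partial_sum xi (N w) w) ->
  (forall j, indep_maps P N (partial_sum xi j)) ->
  nat_tail P N x / F x @[x --> +oo] --> c ->
  nat_tail P (fun w => partial_sum xi (N w) w) x / F x @[x --> +oo] -->
    c * m `^ gamma.
Proof.
move=> mN mS indN Nc.
have mU := partial_sum_measurable iid.
have -> : m `^ gamma = m^-1 `^ (- gamma).
  by rewrite -powR_inv1 ?ltW// -powRrM mulN1r opprK.
apply: (ratio_sandwich F_gt0 F_rv _ Nc) => [|q /andP[q0 qm]|q qm].
- by rewrite invr_gt0.
- have qm1 : q * m < 1 by rewrite -ltr_pdivlMr// div1r.
  have [C C0 hC] :=
    upper_deviation iid r1 m_gt0 partial_mean_le hM M'0 htail q0 qm1.
  exists (fun x => C * truncated_mean N (q * x) * x `^ (- r)).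
    have h := cvg_mul_argument q0 (truncated_mean_negligible mN r1 gr Nc).
    rewrite -[X in _ --> X](mulr0 (C * q `^ r)) -(mul0r (q `^ (- gamma))).
    apply: cvg_trans (cvgMl_tmp (cvgM h (F_rv q0))).
    apply: near_eq_cvg; near=> x.
    have x0 : 0 < x by [].
    have qx0 : 0 < q * x by rewrite mulr_gt0.
    rewrite /= powRM ?(ltW q0) ?(ltW x0)// [q `^ (- r)]powRN.
    by field; rewrite !gt_eqF ?F_gt0 ?powR_gt0.
  near=> x; have x1 : 1 <= x by near: x; apply: nbhs_pinfty_ge; exact: num_real.
  have x0 : 0 < x by lra.
  have qx0 : 0 <= q * x by rewrite mulr_ge0// ltW.
  set n := (Num.truncn (q * x)).+1.
  have mB : measurable [set w | x < (partial_sum xi (N w) w)%:R :> R].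
    exact: nat_measurable_gt.
  rewrite {1}/nat_tail (prob_split P n mN mB) addrC; apply: lerD.
    rewrite nat_tail_truncn//; apply: prob_subset; last by move=> w [].
    - by apply: measurableI => //; exact: (mN [set k | (n <= k)%N]).
    - exact: (mN [set k | (n <= k)%N]).
  apply: (@le_trans _ _ (\sum_(k < n) pmf P N k * (C * (k%:R + 1) * x `^ (- r)))).
    apply: ler_sum => k _.
    apply: (@le_trans _ _ (pmf P N k * nat_tail P (partial_sum xi k) x)).
      rewrite /nat_tail /pmf -(indN k [set (k : nat)] [set i | x < i%:R]).
      apply: prob_subset.
      - by apply: measurableI => //; exact: mN.
      - by apply: measurableI; [exact: mN|exact: (mU k [set i | x < i%:R])].
      - by move=> w /= [] + Nk; rewrite Nk.
    rewrite ler_wpM2l ?pmf_ge0// hC//.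
    by have := ltn_ord k; rewrite /n ltnS truncn_ge_nat.
  rewrite (eq_bigr (fun k : 'I_n =>
    C * x `^ (- r) * (k%:R * pmf P N k + pmf P N k))); last first.
    by move=> k _; ring.
  rewrite -mulr_sumr big_split/= [leRHS]mulrAC ler_wpM2l ?mulr_ge0 ?powR_ge0//.
  by rewrite addrC /truncated_mean lerD2r sum_pmf_le1.
- have q0 : 0 < q by apply: lt_trans qm; rewrite invr_gt0.
  have qm1 : q^-1 < m by rewrite invf_plt ?posrE.
  have qm2 : 0 <= q^-1 < m by rewrite invr_ge0 ltW.
  have [k k0 hk] := lower_deviation iid cvm qm2.
  exists (fun x => 1 - expR (- (k * q * x))), (fun=> 0).
    split; last by under eq_fun do rewrite mul0r; exact: cvg_cst.
    rewrite -[X in _ --> X]subr0; apply: cvgB; first exact: cvg_cst.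
    apply: (cvg_mul_argument (h := fun x => expR (- x))); first exact: mulr_gt0.
    exact: cvgr_expR.
  near=> x; have x0 : 0 < x by [].
  have qx0 : 0 <= q * x by rewrite mulr_ge0// ltW.
  rewrite subr0; set K := (Num.truncn (q * x)).+1.
  have xK : q * x <= K%:R by rewrite ltW// truncnS_gt.
  apply: (@le_trans _ _ (prob P ([set w | (K <= N w)%N] `&`
      [set w | x < (partial_sum xi K w)%:R]))).
    rewrite (indN K [set i | (K <= i)%N] [set i | x < i%:R]) nat_tail_truncn//.
    rewrite ler_wpM2l ?prob_ge0//.
    have -> : partial_sum xi K @^-1` [set i | x < i%:R] =
        ~` [set w | (partial_sum xi K w)%:R <= x].
      by apply/seteqP; split => w /=; rewrite ltNge => /negP.
    rewrite prob_setC; last exact: (mU K [set i | i%:R <= x]).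
    rewrite lerD2l lerN2; apply: (le_trans (hk K x _)).
      by rewrite mulrC ler_pdivlMr// mulrC.
    by rewrite ler_expR lerN2 -mulrA ler_pM2l.
  apply: prob_subset.
  - apply: measurableI; first exact: (mN [set i | (K <= i)%N]).
    exact: (mU K [set i | x < i%:R]).
  - exact: nat_measurable_gt.
  - move=> w /= [KN]; move=> /lt_le_trans; apply.
    by rewrite ler_nat partial_sum_homo.
Unshelve. all: by end_near. Qed.

End random_sums.

(** * The branching process *)

Section immigration_process.
Context d (T : measurableType d) (R : realType) (P : probability T R).

Lemma determined_indep (I : choiceType) (Y : I -> {RV P >-> nat})
    (K1 K2 : set I) (Z1 Z2 : T -> nat) :
  mutually_independent Y -> [disjoint K1 & K2]%classic ->
  determined Y K1 Z1 -> determined Y K2 Z2 -> indep_maps P Z1 Z2.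
Proof.
move=> indY K12 d1 d2 A B; apply: EFin_inj.
have mA := determined_measurable A d1.
have mB := determined_measurable B d2.
rewrite EFinM !EFin_prob//; last exact: measurableI.
exact: (indep_sigma_of indY K12 (d1 A) (d2 B)).
Qed.

Lemma eq_distribution_pmf (Z1 Z2 : {RV P >-> nat}) k :
  eq_distribution Z1 Z2 -> pmf P Z1 k = pmf P Z2 k.
Proof. by move=> h; rewrite /pmf /prob; congr fine; exact: (h [set k]). Qed.

Lemma eq_distribution_nat_tail (Z1 Z2 : {RV P >-> nat}) x :
  eq_distribution Z1 Z2 -> nat_tail P Z1 x = nat_tail P Z2 x.
Proof.
by move=> h; rewrite /nat_tail /prob; congr fine; exact: (h [set k | x < k%:R]).
Qed.

Context (X : nat -> {RV P >-> nat}) (xi : nat -> nat -> {RV P >-> nat}).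
Context (eps : nat -> {RV P >-> nat}).
Hypothesis hX : is_GWI X xi eps.

Let Y := gwi_family (X 0%N) xi eps.

(** The variables that produce the population at time [n]. *)
Definition past (n : nat) : set (unit + (nat * nat + nat)) :=
  [set k | match k with
           | inl _ => True
           | inr (inl ni) => (ni.1 < n)%N
           | inr (inr m) => (m < n)%N
           end].

Definition offspring (n j : nat) : set (unit + (nat * nat + nat)) :=
  [set k | if k is inr (inl ni) then (ni.1 == n) && (ni.2 < j)%N else false].

Lemma past_homo m n : (m <= n)%N -> past m `<=` past n.
Proof. by move=> mn [[]|[[i j]|i]]//= /leq_trans; apply. Qed.

Let steps n := fun i => (xi n i : T -> nat).

Lemma determined_partial_sum n j :
  determined Y (offspring n j) (partial_sum (steps n) j).
Proof.
elim: j => [|j IH].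
  rewrite (_ : partial_sum _ _ = fun=> 0%N); first exact: determined_cst.
  by apply/funext => w; rewrite partial_sum0.
rewrite (_ : partial_sum _ _ =
    fun w => (partial_sum (steps n) j w + steps n j w)%N); last first.
  by apply/funext => w; rewrite partial_sumS.
apply: determined_comp2.
  apply: determined_subset IH => -[[]|[[i k]|i]]//= /andP[-> kj]/=.
  exact: leqW.
by apply: (determined_coord (i := inr (inl (n, j))));
  rewrite /offspring/= eqxx ltnSn.
Qed.

Definition offspring_all n := [set k : unit + (nat * nat + nat) |
  if k is inr (inl ni) then ni.1 == n else false].

Lemma determined_random_sum n : determined Y (past n) (X n) ->
  determined Y (past n `|` offspring_all n)
    (fun w => partial_sum (steps n) (X n w) w).
Proof.
move=> dX; apply: (determined_random (Z := partial_sum (steps n))).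
  by apply: determined_subset dX; exact: subsetUl.
move=> j; apply: determined_subset (@determined_partial_sum n j).
by move=> [[]|[[i k]|i]]//= /andP[? _]; right.
Qed.

Lemma determined_eps (K : set (unit + (nat * nat + nat))) n :
  K (inr (inr n)) -> determined Y K (eps n).
Proof. exact: (determined_coord (i := inr (inr n))). Qed.

Lemma X_recE n :
  (X n.+1 : T -> nat) = fun w => (partial_sum (steps n) (X n w) w + eps n w)%N.
Proof. by apply/funext => w; rewrite (gwi_rec hX). Qed.

Lemma determined_X n : determined Y (past n) (X n).
Proof.
elim: n => [|n IH]; first exact: (determined_coord (i := inl tt)).
rewrite X_recE; apply: determined_comp2; last by apply: determined_eps => /=.
apply: determined_subset (determined_random_sum IH) => k [|].
  exact: past_homo.
by case: k => [[]|[[i k]|i]]//= /eqP ->.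
Qed.

Lemma steps_iid n : iid_steps P (steps n) (pmf P (xi 0%N 0%N)).
Proof.
split.
- by move=> i; exact: nat_measurableRV.
- by move=> j A; exact: (determined_measurable _ (@determined_partial_sum n j)).
- by move=> i k; apply: eq_distribution_pmf; exact: (gwi_xi_id hX).
- move=> j; apply: (determined_indep (gwi_indep hX) _ (@determined_partial_sum n j)
    (determined_coord (K := [set inr (inl (n, j))]) erefl)).
  by apply/disj_setPS => k [+ kE]; rewrite kE /offspring/= ltnn andbF.
Qed.

Lemma X_steps_indep n j : indep_maps P (X n) (partial_sum (steps n) j).
Proof.
apply: (determined_indep (gwi_indep hX) _ (@determined_X n)
  (@determined_partial_sum n j)).
by apply/disj_setPS => -[[]|[[i k]|i]] []//= /[swap] /andP[/eqP -> _]; rewrite ltnn.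
Qed.

Lemma random_sum_eps_indep n :
  indep_maps P (fun w => partial_sum (steps n) (X n w) w) (eps n).
Proof.
apply: (determined_indep (gwi_indep hX) _
  (determined_random_sum (@determined_X n))
  (determined_eps (K := [set inr (inr n)]) erefl)).
by apply/disj_setPS => k [+ kE]; rewrite kE => -[]//=; rewrite ltnn.
Qed.

Context (gamma r : R).
Hypothesis heps : regularly_varying (realRV (eps 0%N)) gamma.
Hypothesis hxi : (P [set w | xi 0%N 0%N w = 0%N] < 1)%E.
Hypothesis r1 : 1 < r.
Hypothesis gr : gamma < r.
Hypothesis xi_r : finite_moment (xi 0%N 0%N) r.
Hypothesis X0_r : finite_moment (X 0%N) r.

Let F := nat_tail P (eps 0%N).

Let F_gt0 x : 0 < x -> 0 < F x.
Proof. by have [_ + _] := heps => /[apply]; rewrite tail_realRV. Qed.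

Let F_rv q : 0 < q -> F (q * x) / F x @[x --> +oo] --> q `^ (- gamma).
Proof.
have [_ _ + q0] := heps => /(_ q q0); apply: cvg_trans; apply: near_eq_cvg.
by apply: nearW => x; rewrite !tail_realRV.
Qed.

Let F_noninc x y : x <= y -> F y <= F x.
Proof.
move=> xy; apply: prob_subset => [||w /=]; last exact: le_lt_trans.
- by apply: nat_measurable_gt; exact: nat_measurableRV.
- by apply: nat_measurable_gt; exact: nat_measurableRV.
Qed.

Let F_cvg0 : F x @[x --> +oo] --> 0.
Proof.
have /fine_cvg := @cvg_ccdfy0 _ _ _ P (realRV (eps 0%N)).
apply: cvg_trans; apply: near_eq_cvg; apply: nearW => x /=.
by rewrite /F -tail_realRV.
Qed.

Definition tail_const (n : nat) : R :=
  \sum_(1 <= i < n.+1) mean (xi 0%N 0%N) `^ ((n - i)%N%:R * gamma).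

Let m_gt0 : 0 < mean (xi 0%N 0%N).
Proof. exact: mean_gt0 r1 xi_r hxi. Qed.

Lemma tail_constS n :
  tail_const n.+1 = tail_const n * mean (xi 0%N 0%N) `^ gamma + 1.
Proof.
rewrite /tail_const big_nat_recr//= subnn mul0r powRr0; congr (_ + _).
rewrite mulr_suml big_nat_cond [RHS]big_nat_cond; apply: eq_bigr => i.
rewrite andbT => /andP[_ ni].
rewrite subSn// -natr1 mulrDl mul1r powRD//.
by apply/implyP => _; rewrite gt_eqF.
Qed.

Lemma X_tail n : nat_tail P (X n) x / F x @[x --> +oo] --> tail_const n.
Proof.
have mean_cv := mean_series r1 xi_r.
have [M hM] := moment_partial_sum xi_r.
have r0 : 0 < r by exact: lt_trans r1.
have [M' M'0 hM'] := nat_tail_le_moment r0 xi_r.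
elim: n => [|n IH].
  have [M0 M00 hM0] := nat_tail_le_moment r0 X0_r.
  have F1 : F x / F x @[x --> +oo] --> (1 : R).
    apply: cvg_near_cst; near=> x; have x0 : 0 < x by [].
    by rewrite divff// gt_eqF// F_gt0.
  have neg := truncated_mean_negligible F_gt0 F_rv F_noninc
    (@nat_measurableRV _ _ _ _ (eps 0%N)) r1 gr F1.
  rewrite /tail_const big_geq//.
  have h : M0 * (x `^ (- r) * truncated_mean P (eps 0%N) x / F x)
      @[x --> +oo] --> (0 : R).
    by rewrite -[X in _ --> X](mulr0 M0); apply: cvgMl_tmp.
  apply: (squeeze_cvgr _ (cvg_cst 0) h).
  near=> x; have x0 : 0 < x by [].
  rewrite divr_ge0 ?nat_tail_ge0//=.
  rewrite !mulrA ler_pM2r ?invr_gt0 ?F_gt0//.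
  apply: le_trans (hM0 _ x0) _; rewrite ler_peMr ?mulr_ge0 ?powR_ge0//.
  by rewrite lerDl sumr_ge0// => k _; rewrite mulr_ge0// pmf_ge0.
rewrite tail_constS X_recE.
have mS : nat_measurable (fun w => partial_sum (steps n) (X n w) w).
  by move=> A; exact: determined_measurable (determined_random_sum (@determined_X n)).
apply: (indep_sum_tail F_gt0 F_rv).
- exact: mS.
- exact: nat_measurableRV.
- by rewrite -X_recE; exact: nat_measurableRV.
- exact: random_sum_eps_indep.
- apply: cvg_trans F_cvg0; apply: near_eq_cvg; apply: nearW => x.
  by apply/esym/eq_distribution_nat_tail; exact: (gwi_eps_id hX).
- apply: (random_sum_tail F_gt0 F_rv F_noninc (steps_iid n) m_gt0 r1 gr
    mean_cv hM M'0 _ (@nat_measurableRV _ _ _ _ (X n)) mS (X_steps_indep n) IH).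
  move=> x x0; rewrite (eq_distribution_nat_tail _ (gwi_xi_id hX n 0%N)).
  exact: hM'.
- apply: cvg_near_cst; near=> x; have x0 : 0 < x by [].
  rewrite (eq_distribution_nat_tail _ (gwi_eps_id hX n)).
  by rewrite divff// gt_eqF// F_gt0.
Unshelve. all: by end_near. Qed.

Lemma tail_const_gt0 n : (1 <= n)%N -> 0 < tail_const n.
Proof.
case: n => // n _; rewrite tail_constS ltr_wpDl//.
by rewrite mulr_ge0 ?powR_ge0// sumr_ge0// => i _; exact: powR_ge0.
Qed.

Lemma X_asymp_equiv n : (1 <= n)%N ->
  asymp_equiv (tail (realRV (X n)))
    (fun x => tail_const n * tail (realRV (eps 0%N)) x).
Proof.
move=> /tail_const_gt0 cn0; rewrite /asymp_equiv.
have h : (tail_const n)^-1 * (nat_tail P (X n) x / F x)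
    @[x --> +oo] --> (tail_const n)^-1 * tail_const n.
  by apply: cvgMl_tmp; exact: X_tail.
rewrite mulVf ?gt_eqF// in h; apply: cvg_trans h; apply: near_eq_cvg.
by apply: nearW => x; rewrite !tail_realRV -/F invfM mulrCA.
Qed.

Lemma X_tail_gt0 n x : (1 <= n)%N -> 0 < x -> 0 < nat_tail P (X n) x.
Proof.
case: n => // n _ x0; apply: (lt_le_trans (F_gt0 x0)).
rewrite /F -(eq_distribution_nat_tail _ (gwi_eps_id hX n)).
apply: prob_subset => [||w /=].
- by apply: nat_measurable_gt; exact: nat_measurableRV.
- by apply: nat_measurable_gt; exact: nat_measurableRV.
- by move=> /lt_le_trans; apply; rewrite X_recE ler_nat leq_addl.
Qed.

Lemma X_regularly_varying n : (1 <= n)%N ->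
  regularly_varying (realRV (X n)) gamma.
Proof.
move=> n1; have cn0 := tail_const_gt0 n1; split.
- by move=> w; exact: ler0n.
- by move=> x x0; rewrite tail_realRV; exact: X_tail_gt0.
move=> q q0.
have h : nat_tail P (X n) (q * x) / F x / (nat_tail P (X n) x / F x)
    @[x --> +oo] --> tail_const n * q `^ (- gamma) / tail_const n.
  apply: cvgM; first exact: (rescale_ratio F_gt0 F_rv q0 (@X_tail n)).
  by apply: cvgV; [rewrite gt_eqF|exact: X_tail].
rewrite mulrAC divff ?gt_eqF// mul1r in h; apply: cvg_trans h.
apply: near_eq_cvg; near=> x; have x0 : 0 < x by [].
rewrite !tail_realRV; field.
by rewrite !gt_eqF ?F_gt0 ?X_tail_gt0.
Unshelve. all: by end_near. Qed.

End immigration_process.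

Theorem proposition2p4 (d : measure_display) (T : measurableType d)
    (R : realType) (P : probability T R)
    (X : nat -> {RV P >-> nat}) (xi : nat -> nat -> {RV P >-> nat})
    (eps : nat -> {RV P >-> nat}) (gamma : R)
    (hX : is_GWI X xi eps)
    (hgamma : 0 <= gamma)
    (heps : regularly_varying (realRV (eps 0%N)) gamma)
    (hxi : (P [set w | xi 0%N 0%N w = 0%N] < 1)%E)
    (hr : exists r : R, [/\ Num.max 1 gamma < r,
            finite_moment (xi 0%N 0%N) r & finite_moment (X 0%N) r]) :
  forall n : nat, (1 <= n)%N ->
    asymp_equiv (tail (realRV (X n)))
      (fun x => (\sum_(1 <= i < n.+1)
                   mean (xi 0%N 0%N) `^ ((n - i)%N%:R * gamma))
                * tail (realRV (eps 0%N)) x) /\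
    regularly_varying (realRV (X n)) gamma.
Proof.
have [r [r_max xi_r X0_r]] := hr.
have [r1 gr] : 1 < r /\ gamma < r by move: r_max; rewrite gt_max => /andP.
move=> n n1; split.
  exact: (X_asymp_equiv hX heps hxi r1 gr xi_r X0_r n1).
exact: (X_regularly_varying hX heps hxi r1 gr xi_r X0_r n1).
Qed.
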